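(* Let $d\ge2$, $\alpha=d/2$ and $\beta>1/2$. There is a constant $c>0$ independent of $n$ such that for all $n\ge2$, $$e_n\big(\mathrm{H}^{d/2,\beta}(\mathbb{S}^d)\big)\ge c\, n^{-1/2}(\ln n)^{-\beta+1/2}.$$
   Context: Let $d\ge2$, let $\mathbb{S}^d$ be the unit sphere in $\mathbb{R}^{d+1}$, and let $\sigma_d$ be its normalized surface measure. Let $L_2=L_2(\mathbb{S}^d,\sigma_d)$. Let $H_\ell(f)$ be the $L_2$-orthogonal projection of $f$ onto the space $\mathcal{H}^d_\ell$ of spherical harmonics of degree $\ell$. For $\alpha>0$ and $\beta\in\mathbb{R}$ let $\lambda^{(\alpha,\beta)}_\ell=(1+\ell(\ell+d-1))^{-\alpha/2}(\ln(3+\ell(\ell+d-1)))^{-\beta}$. Define $$\mathrm{H}^{\alpha,\beta}(\mathbb{S}^d)=\Big\{f\in L_2:\ \sum_{\ell\ge0}(\lambda^{(\alpha,\beta)}_\ell)^{-2}\|H_\ell(f)\|_{L_2}^2<\infty\Big\}$$ with norm the square root of that sum. For $\alpha=d/2$ and $\beta>1/2$ this is a reproducing kernel Hilbert space of continuous functions. For such a space $H$, the optimal quadrature error is $$e_n(H)=\inf_{c\in\mathbb{R}^n,\ x_1,\dots,x_n\in\mathbb{S}^d}\sup_{\|f\|_H\le1}\Big|\int f\,d\sigma_d-\sum_{j=1}^nc_jf(x_j)\Big|.$$ *)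

(* Defs.v *)
From HB Require Import structures.
From mathcomp Require Import all_boot all_order all_algebra.
From mathcomp Require Import all_classical all_reals all_analysis.
From mathcomp Require mpoly.


Import Order.TTheory GRing.Theory Num.Theory.
Local Open Scope classical_set_scope.
Local Open Scope ring_scope.

Section SphereDefs.
Variable R : realType.

(* Points of R^{d+1}: (d+1)-tuples of reals.  The measurable structure is the
   library's product sigma-algebra (generated by the coordinate maps), i.e. the
   Borel sigma-algebra of R^{d+1}. *)
Definition pt (d : nat) := (d.+1).-tuple R.

Definition sphere (d : nat) : set (pt d) :=
  [set x | \sum_(i < d.+1) (tnth x i) ^+ 2 = 1].

Definition mx_act (d : nat) (Q : 'M[R]_(d.+1)) (x : pt d) : pt d :=
  [tuple \sum_(j < d.+1) Q i j * tnth x j | i < d.+1].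

(* sigma_d : normalized surface measure on S^d, characterized as the
   (unique) Borel probability measure on R^{d+1} concentrated on S^d and
   invariant under the orthogonal group O(d+1). *)
Definition normalized_surface_measure (d : nat)
    (sig : probability (pt d) R) : Prop :=
  sig (~` sphere d) = 0%E /\
  forall Q : 'M[R]_(d.+1), Q^T *m Q = 1%:M ->
    forall A : set (pt d), measurable A -> sig (mx_act d Q @^-1` A) = sig A.

Definition harmonic_homog_poly (d l : nat) (p : mpoly.mpoly d.+1 R) : Prop :=
  all (fun m => mpoly.mdeg m == l) (mpoly.msupp p) /\
  \sum_(i < d.+1) mpoly.mderiv i (mpoly.mderiv i p) = 0.

Definition sph_harm (d l : nat) (h : pt d -> R) : Prop :=
  exists p : mpoly.mpoly d.+1 R, harmonic_homog_poly d l p /\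
    forall x, sphere d x -> h x = mpoly.meval (tnth x) p.

Definition is_proj_harm (d : nat) (sig : probability (pt d) R) (l : nat)
    (f g : pt d -> R) : Prop :=
  sph_harm d l g /\
  forall h, sph_harm d l h ->
    (\int[sig]_(x in sphere d) ((f x - g x) * h x)%:E = 0)%E.

Definition lambda_ab (d : nat) (alpha beta : R) (l : nat) : R :=
  let t := l%:R * (l%:R + d%:R - 1) in
  (1 + t) `^ (- (alpha / 2)) * (ln (3 + t)) `^ (- beta).

(* ||f||^2 in H^{alpha,beta}, given the projections g l = H_l(f). *)
Definition H_norm2 (d : nat) (sig : probability (pt d) R) (alpha beta : R)
    (g : nat -> pt d -> R) : \bar R :=
  (\sum_(0 <= l <oo)
     ((lambda_ab d alpha beta l) ^-2)%:E *
       \int[sig]_(x in sphere d) ((g l x) ^+ 2)%:E)%E.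

Definition continuous_on_sphere (d : nat) (f : pt d -> R) : Prop :=
  forall x, sphere d x -> forall e : R, 0 < e -> exists2 delta : R, 0 < delta &
    forall y, sphere d y -> (forall i, `|tnth y i - tnth x i| < delta) ->
      `|f y - f x| < e.

(* The closed unit ball of H^{alpha,beta}(S^d), viewed (as in the paper, in the
   RKHS regime) as a space of continuous functions on S^d: f is continuous on
   S^d (hence in L2), and ||f||_H <= 1. *)
Definition H_unit_ball (d : nat) (sig : probability (pt d) R) (alpha beta : R)
    (f : pt d -> R) : Prop :=
  measurable_fun (sphere d) f /\ continuous_on_sphere d f /\
  exists g : nat -> pt d -> R,
    (forall l, is_proj_harm d sig l f (g l)) /\
    (H_norm2 d sig alpha beta g <= 1)%E.

Definition quad_err (d n : nat) (sig : probability (pt d) R)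
    (c : 'I_n -> R) (X : 'I_n -> pt d) (f : pt d -> R) : R :=
  `| fine (\int[sig]_(x in sphere d) (f x)%:E) - \sum_(j < n) c j * f (X j) |.

Definition e_n (d : nat) (sig : probability (pt d) R) (alpha beta : R)
    (n : nat) : \bar R :=
  ereal_inf [set s : \bar R | exists (c : 'I_n -> R) (X : 'I_n -> pt d),
    (forall j, sphere d (X j)) /\
    s = ereal_sup [set (quad_err d n sig c X f)%:E |
                   f in [set f | H_unit_ball d sig alpha beta f]]].

End SphereDefs.

(* Main.v *)
(* For any n nodes, it suffices to find a function in the unit ball that vanishes at the nodes and
   has a large integral.  Take polynomial features phi_a on the sphere with
   \sum_a phi_a(x)^2 = 1: scaled orthonormal bases of the spaces of polynomials of degree at most
   d 2^(S+r), for r < S, where 2^S is of order n.  Let Q be the orthogonal projector, of rank at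
   most n, onto the span of the feature vectors of the nodes.  Then F(x) = 1 - |phi(x) Q|^2 vanishes
   at the nodes, takes values in [0, 1], and has integral at least 1/2, as the covariance of the
   features has norm at most 2^(-dS) <= 1/(2n).  Grouping the products phi_a phi_b by the larger of
   the two scales writes |phi Q|^2 as a sum of G_r of degree at most 2d 2^(S+r), with
   \sum_r 2^(d(S+r)) |G_r|_2^2 <= 4n/S.  The spreading over S scales is what gains the factor 1/S,
   and a Hardy-type summation gives |F|_H^2 <= C n S^(2 beta - 1).

   The only facts about spherical harmonics that are needed are the orthogonality of a harmonic
   of degree l to all polynomials of lower degree, which follows by integration by parts from
   invariance under plane rotations, and Bessel's inequality. *)

Require Import Defs.
From HB Require Import structures.
From mathcomp Require Import all_boot all_order all_algebra.
From mathcomp Require Import all_classical all_reals all_analysis.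
From mathcomp Require Import measurable_realfun.
From mathcomp Require mpoly.
From mathcomp Require Import ring lra zify.
Import -(notations) mpoly.

Set Implicit Arguments.
Unset Strict Implicit.
Unset Printing Implicit Defensive.

Import Order.TTheory GRing.Theory Num.Theory.
Local Open Scope classical_set_scope.
Local Open Scope ring_scope.

(** * Polynomials on the sphere and the orthogonal action *)

Section Evaluation.
Variables (R : realType) (d : nat).
Local Notation sph := (sphere R d).
Local Notation mp := (mpoly d.+1 R).
Local Notation act := (mx_act R d).
Local Notation ev x p := (meval (tnth x) p).
Local Notation "''X_' i" := (mpolyX R (mnm1 i)) (at level 8, i at level 2).

(** Expansion into monomials leaves only constants and variables to check. Measurability, the
    Lipschitz bound and the second-order expansion along rotations are all proved this way. *)
Lemma mpoly_ring_ind (n : nat) (P : mpoly n R -> Prop) :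
  (forall c, P (mpolyC n c)) -> (forall i, P 'X_i) ->
  (forall p q, P p -> P q -> P (p + q)) ->
  (forall p q, P p -> P q -> P (p * q)) -> forall p, P p.
Proof.
move=> PC PX PD PM p; rewrite (mpolyE p).
apply: big_ind => [||m _]; [by rewrite -(mpolyC0 n R)|exact: PD|].
rewrite -mul_mpolyC; apply: (PM) => //; rewrite mpolyXE_id.
apply: big_ind => [||i _]; [by rewrite -(mpolyC1 n R)|exact: PM|].
elim: (m i) => [|k IH]; first by rewrite expr0 -(mpolyC1 n R).
by rewrite exprS; apply: PM.
Qed.

Lemma measurable_meval (p : mp) : measurable_fun [set: pt R d] (fun x => ev x p).
Proof.
elim/mpoly_ring_ind: p => [c|i|p q mp_ mq|p q mp_ mq].
- by under eq_fun do rewrite mevalC; exact: measurable_cst.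
- by under eq_fun do rewrite mevalXU; exact: measurable_tnth.
- by under eq_fun do rewrite mevalD; exact: measurable_funD.
- by under eq_fun do rewrite mevalM; exact: measurable_funM.
Qed.

Lemma measurable_sphere : measurable sph.
Proof.
pose p : mp := \sum_i 'X_i ^+ 2.
have -> : sph = (fun x => ev x p) @^-1` [set 1].
  have pE x : ev x p = \sum_i tnth x i ^+ 2.
    by rewrite /p raddf_sum /=; apply: eq_bigr => i _; rewrite rmorphXn /= mevalXU.
  by apply/seteqP; split => x; rewrite /sphere /= pE.
by rewrite -[X in measurable X]setTI; exact: measurable_meval.
Qed.

Lemma sphere_coord_le1 x i : sph x -> `|tnth x i| <= 1.
Proof.
rewrite /sphere /= => hx; rewrite -(@expr_le1 _ 2)// real_normK ?num_real//.
by rewrite -hx (bigD1 i)//= lerDl sumr_ge0// => j _; exact: sqr_ge0.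
Qed.

(** One constant serves both as a bound and as a Lipschitz constant, so that the induction passes
    through products by the Leibniz splitting. *)
Lemma meval_sphere_lipschitz (p : mp) : exists C : R, forall x y, sph x -> sph y ->
  `|ev x p| <= C /\ `|ev x p - ev y p| <= C * \sum_i `|tnth x i - tnth y i|.
Proof.
have D0 (x y : pt R d) : 0 <= \sum_i `|tnth x i - tnth y i|.
  by apply: sumr_ge0.
elim/mpoly_ring_ind: p => [c|i|p q [C hC] [D hD]|p q [C hC] [D hD]].
- by exists `|c| => x y _ _; rewrite !mevalC subrr normr0 mulr_ge0.
- exists 1 => x y hx hy; rewrite !mevalXU mul1r; split.
    exact: sphere_coord_le1.
  by rewrite (bigD1 i)//= lerDl sumr_ge0.
- exists (C + D) => x y hx hy; rewrite !mevalD.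
  have [a b] := hC _ _ hx hy; have [a' b'] := hD _ _ hx hy.
  rewrite mulrDl opprD addrACA; split;
    by apply: (le_trans (ler_normD _ _)); apply: lerD.
- exists (C * D + C * D) => x y hx hy; rewrite !mevalM.
  have [a b] := hC _ _ hx hy; have [a' b'] := hD _ _ hx hy.
  have [e _] := hC _ _ hy hx; have [e' _] := hD _ _ hy hx.
  have C0 := le_trans (normr_ge0 _) a; have D0' := le_trans (normr_ge0 _) a'.
  split.
    rewrite normrM; apply: (@le_trans _ _ (C * D)); last by rewrite lerDl mulr_ge0.
    exact: ler_pM.
  have -> : ev x p * ev x q - ev y p * ev y q =
    (ev x p - ev y p) * ev x q + ev y p * (ev x q - ev y q) by ring.
  apply: (le_trans (ler_normD _ _)); rewrite [leRHS]mulrDl; apply: lerD.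
    by rewrite normrM mulrAC; exact: ler_pM.
  by rewrite normrM -mulrA; exact: ler_pM.
Qed.

Lemma continuous_on_sphere_meval (p : mp) :
  continuous_on_sphere R d (fun x => ev x p).
Proof.
have [C hC] := meval_sphere_lipschitz p.
move=> x hx e e0; have [C0 _] := hC _ _ hx hx.
have {}C0 := le_trans (normr_ge0 _) C0.
have K0 : 0 < (C + 1) * d.+1%:R by rewrite mulr_gt0// ltr_wpDl.
exists (e / ((C + 1) * d.+1%:R)); first exact: divr_gt0.
move=> y hy hxy; have [_] := hC _ _ hy hx; move/le_lt_trans; apply.
have S0 : 0 <= \sum_i `|tnth y i - tnth x i| by apply: sumr_ge0.
apply: (@le_lt_trans _ _ ((C + 1) * \sum_i `|tnth y i - tnth x i|)).
  by rewrite ler_wpM2r// lerDl.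
rewrite -ltr_pdivlMl ?ltr_wpDl//.
apply: (@lt_le_trans _ _ (\sum_(i < d.+1) e / ((C + 1) * d.+1%:R))).
  by apply: ltr_sum => //; apply/hasP; exists ord0; rewrite ?mem_index_enum.
rewrite sumr_const card_ord -[leLHS]mulr_natr.
have C1 : C + 1 != 0 by rewrite gt_eqF// ltr_wpDl.
rewrite le_eqVlt; apply/orP; left; apply/eqP; field.
by rewrite C1 /= addrC natr1 pnatr_eq0.
Qed.

Definition dotp (x y : pt R d) : R := \sum_i tnth x i * tnth y i.

Lemma sphereE x : sph x <-> dotp x x = 1.
Proof. by rewrite /sphere /dotp /=; under eq_bigr do rewrite expr2. Qed.

Lemma dotpC x y : dotp x y = dotp y x.
Proof. by apply: eq_bigr => i _; rewrite mulrC. Qed.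

Lemma sqr_dist_sphere x y : sph x -> sph y ->
  \sum_i (tnth x i - tnth y i) ^+ 2 = 2 - 2 * dotp x y.
Proof.
move=> hx hy; transitivity (\sum_i (tnth x i ^+ 2 + tnth y i ^+ 2 -
  2 * (tnth x i * tnth y i))); first by apply: eq_bigr => i _; ring.
by rewrite sumrB big_split/= -mulr_sumr hx hy.
Qed.

Definition comp_mx (Q : 'M[R]_(d.+1)) (p : mp) : mp :=
  comp_mpoly [tuple \sum_j (Q i j) *: 'X_j | i < d.+1] p.

Lemma meval_comp_mx Q p x : ev x (comp_mx Q p) = ev (act Q x) p.
Proof.
rewrite /comp_mx comp_mpoly_meval; apply: meval_eq => i.
rewrite /mx_act !tnth_mktuple raddf_sum /=; apply: eq_bigr => j _.
by rewrite mevalZ mevalXU.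
Qed.

Lemma mx_actM Q P x : act (Q *m P) x = act Q (act P x).
Proof.
apply: eq_from_tnth => i; rewrite !tnth_mktuple.
under [RHS]eq_bigr do rewrite tnth_mktuple mulr_sumr.
rewrite exchange_big/=; apply: eq_bigr => j _; rewrite mxE mulr_suml.
by apply: eq_bigr => k _; rewrite mulrA.
Qed.

Lemma mx_act1 x : act 1%:M x = x.
Proof.
apply: eq_from_tnth => i; rewrite !tnth_mktuple (bigD1 i)//= mxE eqxx mul1r.
rewrite big1 ?addr0// => j ji; by rewrite mxE eq_sym (negbTE ji) mul0r.
Qed.

Lemma dotp_mx_act Q x y : dotp (act Q x) y = dotp x (act Q^T y).
Proof.
rewrite /dotp; under eq_bigr do rewrite tnth_mktuple mulr_suml.
rewrite exchange_big/=; apply: eq_bigr => j _; rewrite tnth_mktuple mulr_sumr.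
by apply: eq_bigr => i _; rewrite mxE; ring.
Qed.

Lemma sphere_mx_act Q x : Q^T *m Q = 1%:M -> sph (act Q x) <-> sph x.
Proof. by move=> hQ; rewrite !sphereE dotp_mx_act -mx_actM hQ mx_act1. Qed.

Lemma measurable_mx_act Q : measurable_fun [set: pt R d] (act Q).
Proof.
apply/measurable_fun_tnthP => i.
have -> : (@tnth _ _ ^~ i \o act Q) = fun x => ev x (comp_mx Q 'X_i).
  by apply/funext => x /=; rewrite meval_comp_mx mevalXU.
exact: measurable_meval.
Qed.

Lemma measurable_halfspace (w : pt R d) (eta : R) :
  measurable [set z | eta < dotp w z].
Proof.
pose p : mp := \sum_i (tnth w i) *: 'X_i.
have pE z : ev z p = dotp w z.
  by rewrite /p raddf_sum/=; apply: eq_bigr => i _; rewrite mevalZ mevalXU.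
have -> : [set z | eta < dotp w z] = (fun z => ev z p) @^-1` `]eta, +oo[%classic.
  by apply/seteqP; split=> z /=; rewrite in_itv/= andbT pE.
by rewrite -[X in measurable X]setTI; exact: measurable_meval.
Qed.

(* Householder reflection along x - y. *)
Lemma sphere_transitive x y : sph x -> sph y ->
  exists2 Q : 'M[R]_(d.+1), Q^T *m Q = 1%:M & act Q y = x.
Proof.
move=> hx hy; pose w := \col_i (tnth x i - tnth y i).
pose s := 2 - 2 * dotp x y.
have ws : w^T *m w = s%:M.
  apply/matrixP => i j; rewrite !ord1 !mxE eqxx mulr1n /s -sqr_dist_sphere//.
  by apply: eq_bigr => k _; rewrite !mxE expr2.
have [s0|s0] := eqVneq s 0.
  exists 1%:M; first by rewrite trmx1 mulmx1.
  rewrite mx_act1; apply: eq_from_tnth => i; apply/eqP; rewrite eq_sym -subr_eq0.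
  rewrite -sqrf_eq0; move: s0; rewrite /s -sqr_dist_sphere// => /eqP.
  by rewrite psumr_eq0 => [/allP/(_ i)|j _]; rewrite ?sqr_ge0// mem_index_enum => /(_ isT).
exists (1%:M - (2 / s) *: (w *m w^T)).
  have -> : (1%:M - (2 / s) *: (w *m w^T))^T = 1%:M - (2 / s) *: (w *m w^T).
    by apply/matrixP => i j; rewrite !mxE !big_ord1 !mxE eq_sym; congr (_ - _ * _);
       exact: mulrC.
  (* [w *m w^T] is [s] times a projector, so the factor [2 / s] makes the symmetric matrix an
     involution. *)
  have ww : (w *m w^T) *m (w *m w^T) = s *: (w *m w^T).
    by rewrite mulmxA -(mulmxA w) ws mul_mx_scalar -scalemxAl.
  rewrite mulmxBl mul1mx mulmxBr mulmx1 -scalemxAl -scalemxAr ww !scalerA.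
  rewrite -addrA -scalerBl -scaleNr -scalerBl [X in X *: _](_ : _ = 0) ?scale0r ?addr0//.
  by field.
apply: eq_from_tnth => i; rewrite tnth_mktuple.
transitivity (tnth y i - (2 / s) * w i 0 * \sum_j (tnth x j * tnth y j - tnth y j * tnth y j)).
  have yE : \sum_j (i == j)%:R * tnth y j = tnth y i.
    rewrite (bigD1 i)//= eqxx mul1r big1 ?addr0// => j ji.
    by rewrite eq_sym (negbTE ji) mul0r.
  rewrite mulr_sumr -{1}yE -sumrB; apply: eq_bigr => j _.
  by rewrite !mxE big_ord1 !mxE; ring.
rewrite sumrB; have := hy; rewrite sphereE /dotp => ->.
by rewrite -/(dotp x y) mxE; move: s0; rewrite /s => s0; field.
Qed.

End Evaluation.

(** * Integration of polynomials against the surface measure *)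

Section SphereIntegral.
Variables (R : realType) (d : nat) (sig : probability (pt R d) R).
Hypothesis sigP : normalized_surface_measure R d sig.
Local Notation sph := (sphere R d).
Local Notation mp := (mpoly d.+1 R).
Local Notation act := (mx_act R d).
Local Notation ev x p := (meval (tnth x) p).
Local Notation "''X_' i" := (mpolyX R (mnm1 i)) (at level 8, i at level 2).

Definition sph_int (p : mp) : R := \int[sig]_(x in sph) ev x p.
Local Notation I := sph_int.

Lemma surface_measure_sphere : sig sph = 1%E.
Proof.
have /= h := probability_setC sig (@measurable_sphere R d).
have [h0 _] := sigP; rewrite h0 in h.
have f1 : sig sph \is a fin_num by exact: fin_num_measure (@measurable_sphere R d).
rewrite -(fineK f1); congr EFin; move/eqP: h.
by rewrite -(fineK f1) -EFinB eqe eq_sym subr_eq0 => /eqP.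
Qed.

Lemma integrable_meval (p : mp) : sig.-integrable sph (EFin \o (fun x => ev x p)).
Proof.
have [C hC] := meval_sphere_lipschitz p.
apply: measurable_bounded_integrable; first exact: measurable_sphere.
- exact: (le_lt_trans (probability_le1 sig (@measurable_sphere R d)) (ltry 1)).
- exact: measurable_funTS (measurable_meval p).
- exists C; split; first exact: num_real.
  by move=> M CM x /= hx; apply: le_trans (ltW CM); have [] := hC _ _ hx hx.
Qed.

Lemma sph_intE (p : mp) : (\int[sig]_(x in sph) (ev x p)%:E)%E = (I p)%:E.
Proof.
by rewrite /sph_int /Rintegral fineK//; apply: integrable_fin_num;
  [exact: measurable_sphere|exact: integrable_meval].
Qed.

Lemma sph_intD : {morph I : p q / p + q}.
Proof.
move=> p q; rewrite /sph_int -RintegralD//;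
  [|exact: measurable_sphere|exact: integrable_meval|exact: integrable_meval].
by apply: eq_Rintegral => x _; rewrite mevalD.
Qed.

Lemma sph_intZ c p : I (c *: p) = c * I p.
Proof.
rewrite /sph_int -RintegralZl//; [|exact: measurable_sphere|exact: integrable_meval].
by apply: eq_Rintegral => x _; rewrite mevalZ.
Qed.

(** The instance built from this lets [raddf_sum], [raddfB] and [linearZ] rewrite under the
    integral. *)
Lemma sph_int_linear : linear_for *%R I.
Proof. by move=> c p q; rewrite sph_intD sph_intZ. Qed.

HB.instance Definition _ := GRing.isLinear.Build R mp R _ I sph_int_linear.

Lemma eq_sph_int p q : (forall x, sph x -> ev x p = ev x q) -> I p = I q.
Proof. by move=> h; apply: eq_Rintegral => x /set_mem; exact: h. Qed.

Lemma le_sph_int p q : (forall x, sph x -> ev x p <= ev x q) -> I p <= I q.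
Proof.
by move=> h; apply: le_Rintegral => //;
  [exact: measurable_sphere|exact: integrable_meval|exact: integrable_meval].
Qed.

Lemma sph_intC c : I (mpolyC _ c) = c.
Proof.
rewrite /sph_int; under eq_Rintegral do rewrite mevalC.
rewrite Rintegral_cst; last exact: measurable_sphere.
by rewrite -[RHS]mulr1; congr (_ * _); exact: (congr1 fine surface_measure_sphere).
Qed.

Lemma sph_int1 : I 1 = 1.
Proof. by rewrite -(mpolyC1 d.+1 R) sph_intC. Qed.

Lemma sph_int_ge0 p : (forall x, sph x -> 0 <= ev x p) -> 0 <= I p.
Proof.
by move=> h; rewrite -(sph_intC 0); apply: le_sph_int => x hx; rewrite mevalC h.
Qed.

Lemma sph_int_sqr_ge0 p : 0 <= I (p ^+ 2).
Proof. by apply: sph_int_ge0 => x _; rewrite rmorphXn/= sqr_ge0. Qed.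

(** Change of variables: the pushforward of [sig] under an orthogonal matrix agrees with [sig] on
    measurable sets. *)
Lemma sph_int_comp_mx (Q : 'M[R]_(d.+1)) p : Q^T *m Q = 1%:M -> I (comp_mx Q p) = I p.
Proof.
move=> hQ; have [_ inv] := sigP.
have mQ := measurable_mx_act Q.
apply: EFin_inj; rewrite -!sph_intE.
have pre : act Q @^-1` sph = sph.
  by apply/seteqP; split => x /=; rewrite sphere_mx_act.
rewrite -[LHS](_ : (\int[pushforward sig (act Q)]_(x in sph) (ev x p)%:E)%E = _); last first.
  rewrite integral_pushforward//=.
  - rewrite pre; apply: eq_integral => x _ /=.
    by rewrite meval_comp_mx.
  - by apply/measurable_EFinP; exact: measurable_meval.
  - rewrite pre; have := integrable_meval (comp_mx Q p).
    by apply: eq_integrable; [exact: measurable_sphere|move=> x _ /=; rewrite meval_comp_mx].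
  - exact: measurable_sphere.
by apply: eq_measure_integral => A mA _; exact: inv.
Qed.

(** An orthogonal matrix that sends [y] to [x] carries the cap around [y] onto the cap around
    [x]. *)
Lemma surface_measure_cap (x y : pt R d) (eta : R) : sph x -> sph y ->
  sig (sph `&` [set z | eta < dotp x z]) = sig (sph `&` [set z | eta < dotp y z]).
Proof.
move=> hx hy; have [Q hQ Qy] := sphere_transitive hx hy.
have [_ inv] := sigP.
have dE z : dotp x (act Q z) = dotp y z.
  by rewrite -Qy dotp_mx_act -mx_actM hQ mx_act1.
have mcap : measurable (sph `&` [set z | eta < dotp x z]).
  by apply: measurableI; [exact: measurable_sphere|exact: measurable_halfspace].
rewrite -(inv Q hQ _ mcap); congr (sig _).
by apply/seteqP; split => z /=; rewrite sphere_mx_act// dE.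
Qed.

(* Countably many congruent caps cover the sphere. *)
Lemma surface_measure_cap_neq0 (x : pt R d) (eta : R) : sph x -> eta < 1 ->
  sig (sph `&` [set z | eta < dotp x z]) <> 0%E.
Proof.
move=> hx eta1 cap0.
(* Coordinates on the sphere differ by at most 2, so two of its points whose coordinates differ by
   less than [e] have squared distance below [2 * e * d.+1 = 1 - eta], and thus inner product above
   [(1 + eta) / 2 > eta]. *)
pose e := (1 - eta) / (2 * d.+1%:R).
have e0 : 0 < e by rewrite divr_gt0 ?subr_gt0// mulr_gt0.
(* The part of the sphere in a box with rational centre. If non-empty, it lies in a cap around one
   of its own points, which is as null as the given cap. *)
pose B (q : (d.+1).-tuple rat) : set (pt R d) :=
  sph `&` [set z | forall i, `|tnth z i - ratr (tnth q i)| < e / 2].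
pose F n := if unpickle n is Some q then B q else set0.
suff : sig.-negligible sph.
  move/(negligibleP _ (@measurable_sphere R d)) => h.
  have /eqP := etrans (esym h) surface_measure_sphere.
  by rewrite eq_sym onee_eq0.
apply: (@negligibleS _ _ _ _ (\bigcup_n F n)).
  move=> z hz.
  have qex i : exists q : rat, `|tnth z i - ratr q| < e / 2.
    have /rat_in_itvoo[q] : tnth z i - e / 2 < tnth z i + e / 2.
      by rewrite ltrD2l gtrN// divr_gt0.
    rewrite in_itv/= => /andP[a b]; exists q.
    by rewrite distrC ltr_distl a b.
  exists (pickle [tuple xchoose (qex i) | i < d.+1]) => //.
  rewrite /F pickleK; split => // i.
  by rewrite tnth_mktuple; exact: (xchooseP (qex i)).
apply: negligible_bigcup => n; rewrite /F.
case: unpickle => [q|]; last exact: negligible_set0.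
have [[y [hy hyq]]|nB] := pselect (exists y, B q y); last first.
  rewrite [B q](_ : _ = set0); first exact: negligible_set0.
  by apply/seteqP; split => // z Bz; exfalso; apply: nB; exists z.
exists (sph `&` [set z | eta < dotp y z]); split.
- by apply: measurableI; [exact: measurable_sphere|exact: measurable_halfspace].
- by rewrite -cap0; apply: surface_measure_cap.
- move=> z [hz hzq]; split => //=.
  have yz i : `|tnth y i - tnth z i| < e.
    rewrite -[tnth y i](subrK (ratr (tnth q i))) -addrA.
    apply: (le_lt_trans (ler_normD _ _)); rewrite [ltRHS]splitr ltrD//.
    by rewrite distrC.
  have yz2 : \sum_i (tnth y i - tnth z i) ^+ 2 < \sum_(i < d.+1) 2 * e.
    apply: ltr_sum => [|i _]; first by apply/hasP; exists ord0; rewrite ?mem_index_enum.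
    rewrite -real_normK ?num_real// expr2.
    apply: (@le_lt_trans _ _ (2 * `|tnth y i - tnth z i|)).
      rewrite ler_wpM2r//; apply: (le_trans (ler_normB _ _)).
      by rewrite -[2]/(1 + 1) lerD//; exact: sphere_coord_le1.
    by rewrite ltr_pM2l.
  move: yz2; rewrite sqr_dist_sphere// sumr_const card_ord.
  have -> : (2 * e) *+ d.+1 = 1 - eta.
    by rewrite -[LHS]mulr_natr /e; field; rewrite addrC natr1 pnatr_eq0.
  by lra.
Qed.

(** A non-zero value would persist on a cap by continuity; but caps are not null, while [p] vanishes
    almost everywhere. This turns vanishing in the mean square into vanishing at every point of the
    sphere. *)
Lemma sph_int_sqr_eq0 p : I (p ^+ 2) = 0 -> forall x, sph x -> ev x p = 0.
Proof.
move=> Ip0 x hx; apply/eqP; apply: contrapT => /negP px0.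
have [C hC] := meval_sphere_lipschitz p.
have px1 : 0 < `|ev x p| by rewrite normr_gt0.
have [delta d0 hd] := continuous_on_sphere_meval p hx px1.
(* On the sphere, [eta < dotp x z] says that the squared distance is below [delta ^+ 2]. *)
pose eta := 1 - delta ^+ 2 / 2.
apply: (@surface_measure_cap_neq0 x eta hx).
  by rewrite /eta ltrBlDr ltrDl divr_gt0// exprn_gt0.
have ae0 : ae_eq sig sph (fun z => (ev z (p ^+ 2))%:E) (cst 0%E).
  apply/ae_eq_integral_abs; first exact: measurable_sphere.
    by apply/measurable_EFinP; apply: measurable_funTS; exact: measurable_meval.
  rewrite -[RHS]/(0%:E) -Ip0 -sph_intE; apply: eq_integral => z _.
  by rewrite gee0_abs// lee_fin rmorphXn/= sqr_ge0.
apply/negligibleP.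
  by apply: measurableI; [exact: measurable_sphere|exact: measurable_halfspace].
apply: negligibleS ae0 => z /= [hz etaz] /(_ hz)[] /eqP.
rewrite rmorphXn/= sqrf_eq0 => /eqP pz0.
have : `|ev z p - ev x p| < `|ev x p|.
  apply: hd => // i; rewrite -(@ltr_pXn2r _ 2)// ?nnegrE ?ltW// real_normK ?num_real//.
  apply: (@le_lt_trans _ _ (\sum_i (tnth z i - tnth x i) ^+ 2)).
    by rewrite (bigD1 i)//= lerDl sumr_ge0// => j _; exact: sqr_ge0.
  rewrite sqr_dist_sphere// dotpC; move: etaz; rewrite /eta; lra.
by rewrite pz0 sub0r normrN ltxx.
Qed.

End SphereIntegral.

(** * Degree bounds, homogeneity and Euler's identity *)

Section Degree.
Variables (R : realType) (n : nat).
Implicit Types p q : mpoly n R.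
Local Notation "''X_' i" := (mpolyX R (mnm1 i)) (at level 8, i at level 2).

(** [msize] is the total degree plus one, and 0 for the zero polynomial, which therefore satisfies
    every bound. *)
Definition deg_le (k : nat) p := (msize p <= k.+1)%N.

Lemma deg_leP k p : reflect (forall m, m \in msupp p -> mdeg m <= k)%N (deg_le k p).
Proof.
apply: (iffP idP) => [h m mp|h].
  by rewrite -ltnS; apply: leq_trans h; exact: msize_mdeg_lt.
by rewrite /deg_le msizeE big_seq; apply/bigmax_leqP_seq => m mp _; exact: h.
Qed.

Lemma deg_le_trans k l p : (k <= l)%N -> deg_le k p -> deg_le l p.
Proof. by move=> kl h; apply: leq_trans h _; rewrite ltnS. Qed.

Lemma deg_leD k p q : deg_le k p -> deg_le k q -> deg_le k (p + q).
Proof.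
move=> /deg_leP hp /deg_leP hq; apply/deg_leP => m /msuppD_le.
by rewrite mem_cat => /orP[/hp|/hq].
Qed.

Lemma deg_leZ k c p : deg_le k p -> deg_le k (c *: p).
Proof. by move=> /deg_leP hp; apply/deg_leP => m /msuppZ_le /hp. Qed.

Lemma deg_le0 k : deg_le k 0.
Proof. by apply/deg_leP => m; rewrite msupp0. Qed.

Lemma deg_leC k c : deg_le k (mpolyC n c).
Proof.
apply/deg_leP => m; rewrite msuppC; case: eqP => // _.
by rewrite inE => /eqP ->; rewrite mdeg0.
Qed.

Lemma deg_le_sum k (T : Type) (r : seq T) (P : pred T) (F : T -> mpoly n R) :
  (forall i, P i -> deg_le k (F i)) -> deg_le k (\sum_(i <- r | P i) F i).
Proof.
move=> h; elim/big_rec: _ => [|i x Pi hx]; first exact: deg_le0.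
by apply: deg_leD => //; exact: h.
Qed.

Lemma deg_leM k l p q : deg_le k p -> deg_le l q -> deg_le (k + l) (p * q).
Proof.
move=> /deg_leP hp /deg_leP hq; apply/deg_leP => m /msuppM_le /allpairsP[[a b]] /= [/hp ha /hq hb ->].
by rewrite mdegD leq_add.
Qed.

Lemma deg_le_prod (T : finType) (k : T -> nat) (F : T -> mpoly n R) (P : pred T) :
  (forall i, P i -> deg_le (k i) (F i)) -> deg_le (\sum_(i | P i) k i) (\prod_(i | P i) F i).
Proof.
move=> h; elim/big_rec2: _ => [|i x y Pi hx]; first by rewrite -(mpolyC1 n R) deg_leC.
by apply: deg_leM => //; exact: h.
Qed.

Lemma deg_leX k p m : deg_le k p -> deg_le (k * m) (p ^+ m).
Proof.
move=> hp; elim: m => [|m IH]; first by rewrite expr0 -(mpolyC1 n R) deg_leC.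
by rewrite exprS mulnS; exact: deg_leM.
Qed.

Lemma deg_leXU i : deg_le 1 ('X_i : mpoly n R).
Proof. by apply/deg_leP => m; rewrite msuppX inE => /eqP ->; rewrite mdeg1. Qed.

Local Notation hom := (fun l => @ishomog1 n R l mdeg).

Lemma mderivXU i k : mderiv i ('X_k : mpoly n R) = mpolyC n (k == i)%:R.
Proof.
rewrite mderivX mnm1E; have [->|] := eqVneq k i; last by rewrite scale0r mpolyC0.
rewrite scale1r mpolyC1 -(mpolyX0 n R); congr mpolyX.
by apply/mnmP => l; rewrite mnmBE subnn mnm0E.
Qed.

Lemma mderiv_homog i k p : p \is hom k.+1 -> mderiv i p \is hom k.
Proof.
move=> /dhomogP h; apply/dhomogP => m; rewrite mcoeff_msupp mcoeff_mderiv => hm.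
have /h : mnm_add m (mnm1 i) \in msupp p.
  by rewrite mcoeff_msupp; apply: contraNneq hm => ->; rewrite mul0rn.
by rewrite /= mdegD mdeg1 addn1 => -[].
Qed.

Lemma mderiv_homog0 i p : p \is hom 0%N -> mderiv i p = 0.
Proof.
move=> /dhomogP h; rewrite [p]msize1_polyC ?mderivC//.
by apply/deg_leP => m /h /= ->.
Qed.

(** Euler's identity, verified on each monomial. *)
Lemma euler_homog k p : p \is hom k -> \sum_i 'X_i * mderiv i p = k%:R *: p.
Proof.
move=> /dhomogP h; rewrite [in RHS](mpolyE p) scaler_sumr.
transitivity (\sum_(m <- msupp p) \sum_i 'X_i * mderiv i (mcoeff m p *: mpolyX R m)).
  rewrite exchange_big/=; apply: eq_bigr => i _.
  by rewrite {1}(mpolyE p) raddf_sum mulr_sumr.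
rewrite [LHS]big_seq [RHS]big_seq; apply: eq_bigr => m /h /= mk.
rewrite -mk mdegE natr_sum scaler_suml; apply: eq_bigr => i _.
rewrite mderivZ mderivX -!scalerAr scalerA.
(* Subtraction of exponents is truncated, so an absent variable is treated apart; its coefficient is
   zero. *)
have [m0|m0] := eqVneq (m i) 0%N; first by rewrite m0 mulr0 !scale0r.
rewrite -mpolyXD addmC submK ?lep1mP// scalerA; congr (_ *: _).
exact: mulrC.
Qed.

End Degree.

(** * Integration by parts on the sphere and orthogonality of harmonics *)

Section IntegrationByParts.
Variables (R : realType) (d : nat) (sig : probability (pt R d) R).
Hypothesis sigP : normalized_surface_measure R d sig.
Local Notation sph := (sphere R d).
Local Notation mp := (mpoly d.+1 R).
Local Notation act := (mx_act R d).
Local Notation ev x p := (meval (tnth x) p).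
Local Notation "''X_' i" := (mpolyX R (mnm1 i)) (at level 8, i at level 2).
Local Notation I := (sph_int sig).
Local Notation hom := (fun l => @ishomog1 d.+1 R l mdeg).

(** For distinct [i], [j] and [c ^+ 2 + s ^+ 2 = 1], this is the rotation of the coordinate plane of
    [i] and [j] with cosine [c] and sine [s]: the projector onto the plane is weighted by [c - 1]
    and the quarter turn by [s]. *)
Definition plane_rot (i j : 'I_d.+1) (c s : R) : 'M[R]_(d.+1) :=
  1%:M + (c - 1) *: (delta_mx i i + delta_mx j j) + s *: (delta_mx j i - delta_mx i j).

Lemma plane_rot_orthogonal i j c s : i != j -> c ^+ 2 + s ^+ 2 = 1 ->
  (plane_rot i j c s)^T *m plane_rot i j c s = 1%:M.
Proof.
move=> ij cs.
have ji : (j == i) = false by rewrite eq_sym (negbTE ij).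
have {}ij := negbTE ij.
pose P : 'M[R]_(d.+1) := delta_mx i i + delta_mx j j.
pose J : 'M[R]_(d.+1) := delta_mx j i - delta_mx i j.
have PP : P *m P = P.
  by rewrite /P mulmxDl !mulmxDr !mul_delta_mx_cond !eqxx ij ji !mulr0n !mulr1n addr0 add0r.
have PJ : P *m J = J.
  rewrite /P /J mulmxDl !mulmxBr !mul_delta_mx_cond !eqxx ij ji !mulr0n !mulr1n.
  by rewrite subr0 sub0r addrC.
have JP : J *m P = J.
  rewrite /P /J mulmxBl !mulmxDr !mul_delta_mx_cond !eqxx ij ji !mulr0n !mulr1n.
  by rewrite addr0 add0r.
have JJ : J *m J = - P.
  rewrite /P /J mulmxBl !mulmxBr !mul_delta_mx_cond !eqxx ij ji !mulr0n !mulr1n.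
  by rewrite subr0 sub0r opprD addrC.
have -> : (plane_rot i j c s)^T = 1%:M + (c - 1) *: P - s *: J.
  apply/matrixP => k l; rewrite !mxE eq_sym ![(l == _) && _]andbC; ring.
rewrite /plane_rot -/P -/J; clearbody P J.
rewrite mulmxBl !mulmxDl !mulmxDr !mul1mx !mulmx1 -!scalemxAl -!scalemxAr PP PJ JP JJ.
rewrite !scalerN; apply/matrixP => k l; rewrite !mxE.
transitivity ((k == l)%:R + (c ^+ 2 + s ^+ 2 - 1) * P k l); first by ring.
by rewrite cs subrr mul0r addr0.
Qed.

(** The integrand is the derivative of [p] along rotations of a coordinate plane, under which the
    integral is invariant. Instead of differentiating under the integral, a uniform second-order
    expansion yields [s * a <= C * s ^+ 2] for [s] in [[0, 1]], where [a] is the absolute value of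
    the integral; small [s] forces [a = 0]. *)
Lemma sph_int_rot_generator i j p :
  I ('X_i * mderiv j p - 'X_j * mderiv i p) = 0.
Proof.
have [->|ij] := eqVneq i j; first by rewrite subrr raddf0.
pose L q : mp := 'X_i * mderiv j q - 'X_j * mderiv i q.
pose c (s : R) := Num.sqrt (1 - s ^+ 2).
have cP (s : R) : 0 <= s <= 1 -> [/\ c s ^+ 2 + s ^+ 2 = 1 & `|c s - 1| <= s ^+ 2].
  move=> /andP[s0 s1]; have s2 : 0 <= 1 - s ^+ 2 by rewrite subr_ge0 expr_le1.
  have c0 : 0 <= c s by exact: sqrtr_ge0.
  have cc : c s ^+ 2 = 1 - s ^+ 2 by rewrite sqr_sqrtr.
  split; first by rewrite cc; ring.
  have c1 : c s <= 1 by rewrite -(@expr_le1 _ 2)// cc gerBl sqr_ge0.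
  by rewrite distrC ger0_norm ?subr_ge0//; nra.
pose rot s := plane_rot i j (c s) s.
have rotE s x k : tnth (act (rot s) x) k = tnth x k
   + (k == i)%:R * ((c s - 1) * tnth x i - s * tnth x j)
   + (k == j)%:R * ((c s - 1) * tnth x j + s * tnth x i).
  have dE a b : \sum_l (delta_mx a b : 'M[R]_d.+1) k l * tnth x l = (k == a)%:R * tnth x b.
    rewrite (bigD1 b)//= mxE eqxx andbT big1 ?addr0// => l lb.
    by rewrite mxE (negbTE lb) andbF mul0r.
  have iE : \sum_l (1%:M : 'M[R]_d.+1) k l * tnth x l = tnth x k.
    rewrite (bigD1 k)//= mxE eqxx mul1r big1 ?addr0// => l lk.
    by rewrite mxE eq_sym (negbTE lk) mul0r.
  rewrite tnth_mktuple -{1}iE.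
  transitivity (\sum_l (1%:M : 'M[R]_d.+1) k l * tnth x l +
    (c s - 1) * (\sum_l (delta_mx i i : 'M[R]_d.+1) k l * tnth x l +
                 \sum_l (delta_mx j j : 'M[R]_d.+1) k l * tnth x l) +
    s * (\sum_l (delta_mx j i : 'M[R]_d.+1) k l * tnth x l -
         \sum_l (delta_mx i j : 'M[R]_d.+1) k l * tnth x l)).
    rewrite -big_split/= -sumrB !mulr_sumr -!big_split/=.
    by apply: eq_bigr => l _; rewrite !mxE; ring.
  by rewrite !dE; ring.
have taylor q : exists C : R, forall (s : R) x, 0 <= s <= 1 -> sph x ->
    `|ev (act (rot s) x) q - ev x q - s * ev x (L q)| <= C * s ^+ 2.
  elim/mpoly_ring_ind: q => [b|k|q r [C hC] [D hD]|q r [C hC] [D hD]].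
  - exists 0 => s x _ _; rewrite !mevalC /L !mderivC !mulr0 !subrr meval0.
    by rewrite mulr0 subr0 normr0 mul0r.
  - exists 2 => s x s01 hx; have [_ cs] := cP _ s01.
    rewrite !mevalXU rotE /L !mderivXU mevalB !mevalM !mevalXU !mevalC.
    rewrite [X in `|X|](_ : _ = (k == i)%:R * (c s - 1) * tnth x i +
      (k == j)%:R * (c s - 1) * tnth x j); last by ring.
    apply: (le_trans (ler_normD _ _)); rewrite -[2]/(1 + 1) mulrDl !mul1r; apply: lerD.
      rewrite !normrM -[leRHS]mulr1; apply: ler_pM => //; last exact: sphere_coord_le1.
      by case: eqP => _; rewrite ?normr1 ?mul1r// normr0 mul0r sqr_ge0.
    rewrite !normrM -[leRHS]mulr1; apply: ler_pM => //; last exact: sphere_coord_le1.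
    by case: eqP => _; rewrite ?normr1 ?mul1r// normr0 mul0r sqr_ge0.
  - exists (C + D) => s x s01 hx.
    have -> : L (q + r) = L q + L r by rewrite /L !mderivD; ring.
    rewrite 2!(mevalD _ q r) (mevalD _ (L q) (L r)) [X in `|X|](_ : _ = (ev (act (rot s) x) q - ev x q - s * ev x (L q)) +
      (ev (act (rot s) x) r - ev x r - s * ev x (L r))); last by ring.
    by rewrite mulrDl; apply: (le_trans (ler_normD _ _)); apply: lerD; [exact: hC|exact: hD].
  - have [M hM] := meval_sphere_lipschitz q; have [N hN] := meval_sphere_lipschitz r.
    have [M' hM'] := meval_sphere_lipschitz (L q); have [N' hN'] := meval_sphere_lipschitz (L r).
    exists (M * D + C * N + N' * (M' + C)) => s x s01 hx.
    have [cs _] := cP _ s01; have [s0 s1] := andP s01.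
    have hy : sph (act (rot s) x) by apply/sphere_mx_act => //; exact: plane_rot_orthogonal.
    have -> : L (q * r) = L q * r + q * L r by rewrite /L !mderivM; ring.
    rewrite mevalD !mevalM.
    have [a1 _] := hM _ _ hx hx; have [a2 _] := hN _ _ hx hx.
    have [a3 _] := hM' _ _ hx hx; have [a4 _] := hN' _ _ hx hx.
    have [a5 _] := hM _ _ hy hy.
    have := hC _ _ s01 hx; have := hD _ _ s01 hx.
    move: a1 a2 a3 a4 a5.
    set a := ev x q; set b := ev x r; set al := ev x (L q); set be := ev x (L r).
    set a' := ev _ q; set b' := ev _ r => a1 a2 a3 a4 a5 h1 h2.
    (* [L] is a derivation, so the remainder of a product splits into the remainders of its factors
       and a cross term that is a product of two quantities of order [s]. *)
    rewrite [X in `|X|](_ : _ = a' * (b' - b - s * be) + (a' - a - s * al) * b +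
      s * be * (a' - a)); last by ring.
    have C0 : 0 <= C.
      have := hC 1 _ _ hx; rewrite lexx ler01 expr1n mulr1 => /(_ isT).
      exact: le_trans.
    have h3 : `|a' - a| <= s * (M' + C).
      rewrite -[a' - a](subrK (s * al)); apply: (le_trans (ler_normD _ _)).
      rewrite mulrDr addrC lerD//; first by rewrite normrM ger0_norm// ler_wpM2l.
      apply: (le_trans h2); rewrite mulrC expr2 -mulrA ler_wpM2l//.
      by rewrite ler_piMl.
    apply: (le_trans (ler_normD _ _)); rewrite [leRHS]mulrDl; apply: lerD.
      apply: (le_trans (ler_normD _ _)); rewrite [leRHS]mulrDl !normrM; apply: lerD.
        by rewrite -mulrA ler_pM.
      by rewrite mulrAC ler_pM.
    rewrite !normrM (ger0_norm s0).
    rewrite (_ : N' * (M' + C) * s ^+ 2 = s * N' * (s * (M' + C))); last by ring.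
    by rewrite ler_pM ?mulr_ge0// ler_wpM2l.
have [C hC] := taylor p.
rewrite -/(L p).
have key (s : R) : 0 <= s <= 1 -> s * `|I (L p)| <= C * s ^+ 2.
  move=> s01; have [cs _] := cP _ s01; have [s0 _] := andP s01.
  have Irot : I (comp_mx (rot s) p) = I p by apply: sph_int_comp_mx => //; exact: plane_rot_orthogonal.
  have E (q : mp) : s * I q = - I (comp_mx (rot s) p - p - s *: q).
    by rewrite !raddfB /= linearZ/= Irot subrr sub0r opprK.
  have evE (q : mp) x : ev x (comp_mx (rot s) p - p - s *: q) =
      ev (act (rot s) x) p - ev x p - s * ev x q.
    by rewrite !mevalB mevalZ meval_comp_mx.
  rewrite -{1}(ger0_norm s0) -normrM E normrN ler_norml.
  rewrite -(sph_intC sigP (C * s ^+ 2)) -raddfN/=.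
  by apply/andP; split; apply: le_sph_int => x hx; rewrite evE ?mevalN mevalC;
    have := hC _ _ s01 hx; rewrite ler_norml => /andP[].
have C0 : 0 <= C.
  by have := key 1; rewrite lexx ler01 mul1r expr1n mulr1 => /(_ isT); apply: le_trans.
pose a := `|I (L p)|; have a0 : 0 <= a by exact: normr_ge0.
have den : 0 < a + C + 1 by rewrite ltr_wpDl// addr_ge0.
have [/eqP|an0] := eqVneq a 0; first by rewrite normr_eq0 => /eqP.
have ap : 0 < a by rewrite lt_neqAle eq_sym an0.
(* With this [s], the inequality [a <= C * s] turns into [s * (a + 1) <= 0], which is absurd. *)
pose s := a / (a + C + 1).
have sE : s * (a + C + 1) = a by rewrite divfK// gt_eqF.
have s0 : 0 < s by rewrite divr_gt0.
have s1 : s <= 1 by rewrite ler_pdivrMr// mul1r -addrA lerDl addr_ge0.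
have := key s; rewrite (ltW s0) s1 => /(_ isT); rewrite -/a expr2 mulrCA ler_pM2l// => h.
have : s * (a + 1) <= 0 by lra.
by rewrite pmulr_rle0// leNgt ltr_wpDl.
Qed.

(** The rotation fields in the planes of [i] and [j], applied to ['X_i * u] and summed over [i],
    give [r2 * mderiv j u - (m + d)%:R *: ('X_j * u)] by Euler's identity, and [r2] is 1 on the
    sphere. *)
Lemma sph_int_mderiv j m (u : mp) : u \is hom m ->
  I (mderiv j u) = (m + d)%:R * I ('X_j * u).
Proof.
move=> um; pose r2 : mp := \sum_i 'X_i ^+ 2.
have r2E q : I (r2 * q) = I q.
  apply: eq_sph_int => x hx; rewrite mevalM [X in X * _](_ : _ = 1) ?mul1r//.
  rewrite -hx raddf_sum/=; apply: eq_bigr => i _; by rewrite rmorphXn/= mevalXU.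
have S0 : I (\sum_i ('X_i * mderiv j ('X_i * u) - 'X_j * mderiv i ('X_i * u))) = 0.
  by rewrite raddf_sum/= big1// => i _; exact: sph_int_rot_generator.
have : \sum_i ('X_i * mderiv j ('X_i * u) - 'X_j * mderiv i ('X_i * u)) =
   r2 * mderiv j u - (m + d)%:R *: ('X_j * u).
  under eq_bigr do rewrite !mderivM !mderivXU eqxx mpolyC1 mul1r.
  rewrite sumrB -mulr_sumr big_split/= (euler_homog um) sumr_const card_ord.
  under eq_bigr do rewrite mulrDr mulrA -expr2.
  rewrite big_split/= -mulr_suml -/r2 (bigD1 j)//= eqxx mpolyC1 mul1r big1 => [|i ij].
    rewrite addr0 mulrDr -scalerAr mulrnAr !scaler_nat mulrnDr mulrS.
    by move: (_ *+ m) (_ *+ d) => A B; ring.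
  by rewrite (negbTE ij) mpolyC0 mul0r mulr0.
move/(congr1 I); rewrite S0 raddfB/= r2E linearZ/= => /esym/eqP.
by rewrite subr_eq0 => /eqP.
Qed.

Definition laplacian (p : mp) : mp := \sum_i mderiv i (mderiv i p).

(** Green's identity: the field [h * mderiv j p - p * mderiv j h] is homogeneous of degree
    [k + l - 1] and has divergence [h * laplacian p]. The preceding lemma moves the derivative to a
    radial factor, which Euler's identity evaluates. *)
Lemma sph_int_green k l (p h : mp) : p \is hom k -> h \is hom l -> laplacian h = 0 ->
  I (h * laplacian p) = ((k%:R - l%:R) * (k%:R + l%:R + d%:R - 1)) * I (p * h).
Proof.
(* When both degrees vanish, [k + l - 1] is no degree; both polynomials are then constant. *)
move=> pk hl h0; have [kl0|kl0] := eqVneq (k + l)%N 0%N.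
  move/eqP: kl0 pk hl; rewrite addn_eq0 => /andP[/eqP -> /eqP ->] pk _.
  rewrite subrr mul0r mul0r /laplacian big1 ?mulr0 ?raddf0// => i _.
  by rewrite (mderiv_homog0 i pk) mderiv0.
have [m [mE vh]] : exists m : nat, m%:R = k%:R + l%:R - 1 :> R /\
   forall j, h * mderiv j p - p * mderiv j h \is hom m.
  exists (k + l).-1; split; first by rewrite -natrD -(prednK (n := k + l)) ?lt0n// -natr1 addrK.
  move=> j; apply: rpredB.
    case: k pk {kl0} => [|k] pk; first by rewrite (mderiv_homog0 j pk) mulr0 rpred0.
    by rewrite addSn addnC /= dhomogM// mderiv_homog.
  case: l hl {kl0} => [|l] hl; first by rewrite (mderiv_homog0 j hl) mulr0 rpred0.
  by rewrite addnS /= dhomogM// mderiv_homog.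
have Edv : \sum_j mderiv j (h * mderiv j p - p * mderiv j h) = h * laplacian p - p * laplacian h.
  rewrite /laplacian !mulr_sumr -sumrB; apply: eq_bigr => j _.
  by rewrite mderivB !mderivM; ring.
have : I (\sum_j mderiv j (h * mderiv j p - p * mderiv j h)) =
   (m + d)%:R * I (\sum_j 'X_j * (h * mderiv j p - p * mderiv j h)).
  by rewrite !raddf_sum/= mulr_sumr; apply: eq_bigr => j _; exact: sph_int_mderiv.
have -> : \sum_j 'X_j * (h * mderiv j p - p * mderiv j h) = (k%:R - l%:R) *: (p * h).
  under eq_bigr do rewrite mulrBr mulrCA [X in _ - X]mulrCA.
  rewrite sumrB -!mulr_sumr (euler_homog pk) (euler_homog hl) -!scalerAr scalerBl.
  by rewrite [h * p]mulrC.
rewrite Edv h0 mulr0 subr0 linearZ/= natrD mE => ->; ring.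
Qed.

(** Induction on the degree: [laplacian p] has degree [k - 2], or is zero when [k < 2], so the left
    side of Green's identity vanishes while its factor on the right does not. *)
Lemma sph_int_harmonic_homog k l (p h : mp) : (0 < d)%N -> (k < l)%N -> p \is hom k ->
  h \is hom l -> laplacian h = 0 -> I (p * h) = 0.
Proof.
move=> d0 kl pk hl h0; elim/ltn_ind: k p kl pk => k IH p kl pk.
have : I (h * laplacian p) = 0.
  case: k IH kl pk => [|[|k]] IH kl pk.
  - rewrite /laplacian big1 ?mulr0 ?raddf0// => i _.
    by rewrite (mderiv_homog0 i pk) mderiv0.
  - rewrite /laplacian big1 ?mulr0 ?raddf0// => i _.
    by rewrite mderiv_homog0// mderiv_homog.
  - rewrite mulrC; apply: (IH k) => //; first exact: ltnW (ltnW kl).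
    by apply: rpred_sum => i _; do 2 apply: mderiv_homog.
rewrite (sph_int_green pk hl h0) => /eqP; rewrite !mulf_eq0 subr_eq0 eqr_nat (ltn_eqF kl)/=.
(* Here [l] and [d] are both at least 1. *)
have /negbTE -> : k%:R + l%:R + d%:R - 1 != 0 :> R.
  by rewrite gt_eqF// subr_gt0 -!natrD ltr1n; lia.
by move/eqP.
Qed.

Lemma sph_int_harmonic_deg k l (p h : mp) : (0 < d)%N -> (k < l)%N -> deg_le k p ->
  h \is hom l -> laplacian h = 0 -> I (p * h) = 0.
Proof.
move=> d0 kl /deg_leP pk hl h0; rewrite (mpolyE p) mulr_suml raddf_sum/= big_seq big1// => m mp.
rewrite -scalerAl linearZ/= (@sph_int_harmonic_homog (mdeg m) l) ?mulr0//.
  exact: leq_ltn_trans (pk _ mp) kl.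
by rewrite dhomogX /=.
Qed.

End IntegrationByParts.

(** * Cauchy-Schwarz for finite sums *)

Section FiniteSums.
Variable R : realFieldType.

(** Lagrange's identity: twice the gap is a sum of squares. *)
Lemma cauchy_schwarz_sum (T : finType) (P : pred T) (a b : T -> R) :
  (\sum_(i | P i) a i * b i) ^+ 2 <= (\sum_(i | P i) a i ^+ 2) * \sum_(i | P i) b i ^+ 2.
Proof.
have h : 0 <= \sum_(i | P i) \sum_(j | P j) (a i * b j - a j * b i) ^+ 2.
  by apply: sumr_ge0 => i _; apply: sumr_ge0 => j _; exact: sqr_ge0.
have e : \sum_(i | P i) \sum_(j | P j) (a i * b j - a j * b i) ^+ 2 =
   2 * ((\sum_(i | P i) a i ^+ 2) * (\sum_(i | P i) b i ^+ 2) - (\sum_(i | P i) a i * b i) ^+ 2).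
  transitivity (\sum_(i | P i) \sum_(j | P j) (a i ^+ 2 * b j ^+ 2 + b i ^+ 2 * a j ^+ 2
     - 2 * ((a i * b i) * (a j * b j)))).
    by apply: eq_bigr => i _; apply: eq_bigr => j _; ring.
  rewrite (eq_bigr (fun i => a i ^+ 2 * (\sum_(j | P j) b j ^+ 2) +
     b i ^+ 2 * (\sum_(j | P j) a j ^+ 2) - 2 * (a i * b i * (\sum_(j | P j) a j * b j)))); last first.
    by move=> i _; rewrite sumrB big_split/= -!mulr_sumr.
  by rewrite sumrB big_split/= -!mulr_suml -mulr_sumr -mulr_suml; ring.
by rewrite e pmulr_rge0// subr_ge0 in h.
Qed.

Lemma sqr_sum_le (T : finType) (f : T -> R) :
  (\sum_i f i) ^+ 2 <= #|T|%:R * \sum_i f i ^+ 2.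
Proof.
have := cauchy_schwarz_sum xpredT (fun=> 1) f.
rewrite (eq_bigr f) => [|i _]; last by rewrite mul1r.
by under [X in _ <= X * _]eq_bigr do rewrite expr1n; rewrite sumr_const.
Qed.

End FiniteSums.

(** * Orthonormal bases, Christoffel functions and dimension counts *)

Section OrthonormalFamilies.
Variables (R : realType) (d : nat) (sig : probability (pt R d) R).
Hypothesis sigP : normalized_surface_measure R d sig.
Local Notation sph := (sphere R d).
Local Notation mp := (mpoly d.+1 R).
Local Notation act := (mx_act R d).
Local Notation ev x p := (meval (tnth x) p).
Local Notation "''X_' i" := (mpolyX R (mnm1 i)) (at level 8, i at level 2).
Local Notation I := (sph_int sig).

Definition sph_orthonormal (k : nat) (u : 'I_k -> mp) :=
  forall i j, I (u i * u j) = (i == j)%:R.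

(** In terms of the coefficient matrix [A] and the Gram matrix [G] of the monomials, orthonormality
    reads [A *m G *m A^T = 1], so the rank [k] is at most the number of monomials. *)
Lemma sph_orthonormal_card k (u : 'I_k -> mp) m : sph_orthonormal u ->
  (forall i, deg_le m (u i)) -> (k <= #|{: bmultinom d.+1 m.+1}|)%N.
Proof.
move=> ou um; set N := #|_|.
pose X (j : 'I_N) : mp := mpolyX R (bmnm (enum_val j)).
pose A := \matrix_(i < k, j < N) mcoeff (bmnm (enum_val j)) (u i).
pose G := \matrix_(a < N, b < N) I (X a * X b).
have uE i : u i = \sum_j A i j *: X j.
  rewrite [LHS](mpolywE (um i)) (reindex_onto (enum_val (A := {: bmultinom d.+1 m.+1})) enum_rank)/=; last first.
    by move=> ? _; rewrite enum_rankK.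
  by apply: eq_big => [j|j _]; rewrite ?enum_valK ?eqxx// mxE.
have AGA : A *m G *m A^T = 1%:M.
  apply/matrixP => i j; rewrite !mxE -ou.
  rewrite uE mulr_suml raddf_sum/=.
  under eq_bigr do rewrite mxE mulr_suml.
  rewrite exchange_big/=; apply: eq_bigr => a _.
  rewrite -scalerAl linearZ/= (uE j) mulr_sumr raddf_sum/= mulr_sumr.
  by apply: eq_bigr => b _; rewrite -scalerAr linearZ/= !mxE; ring.
rewrite -(mxrank1 R k) -AGA; apply: leq_trans (mxrankM_maxl _ _) _.
by apply: leq_trans (mxrankM_maxl _ _) _; exact: rank_leq_col.
Qed.

Definition residual k (u : 'I_k -> mp) (p : mp) : mp := p - \sum_i I (p * u i) *: u i.

Lemma residual_orth k (u : 'I_k -> mp) p j : sph_orthonormal u ->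
  I (residual u p * u j) = 0.
Proof.
move=> ou; rewrite /residual mulrBl mulr_suml raddfB raddf_sum/= (bigD1 j)//=.
rewrite -scalerAl linearZ/= ou eqxx mulr1 big1 ?addr0 ?subrr// => i ij.
by rewrite -scalerAl linearZ/= ou (negbTE ij) mulr0.
Qed.

Lemma sph_int_residual_sqr k (u : 'I_k -> mp) p : sph_orthonormal u ->
  I (residual u p ^+ 2) = I (p ^+ 2) - \sum_i I (p * u i) ^+ 2.
Proof.
move=> ou; rewrite expr2 {2}/residual mulrBr raddfB/= mulr_sumr raddf_sum/=.
rewrite [X in _ - X]big1 => [|i _]; last by rewrite -scalerAr linearZ/= residual_orth ?mulr0.
rewrite subr0 {1}/residual mulrBl raddfB/= -expr2; congr (_ - _).
rewrite mulr_suml raddf_sum/=; apply: eq_bigr => i _.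
by rewrite -scalerAl linearZ/= [u i * p]mulrC expr2.
Qed.

Lemma bessel k (u : 'I_k -> mp) p : sph_orthonormal u ->
  \sum_i I (p * u i) ^+ 2 <= I (p ^+ 2).
Proof.
by move=> ou; rewrite -subr_ge0 -sph_int_residual_sqr//; exact: sph_int_sqr_ge0.
Qed.

(** A family of maximal size is taken; the degree bound limits the size. A residual of non-zero norm
    could be normalized and added, so all residuals have norm zero. The expansion holds only on the
    sphere because distinct polynomials may agree there. *)
Lemma exists_orthonormal_basis (W : mp -> Prop) m :
  (forall c p q, W p -> W q -> W (c *: p + q)) ->
  W 0 -> (forall p, W p -> deg_le m p) ->
  exists k (u : 'I_k -> mp), [/\ sph_orthonormal u, forall i, W (u i) &
    forall p, W p -> forall x, sph x -> ev x p = \sum_i I (p * u i) * ev x (u i)].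
Proof.
move=> Wlin W0 Wm.
pose P k := `[< exists u : 'I_k -> mp, sph_orthonormal u /\ forall i, W (u i) >].
have P0 : exists k, P k.
  by exists 0%N; apply/asboolP; exists (fun=> 0); split => [[]|[]].
have Pb k : P k -> (k <= #|{: bmultinom d.+1 m.+1}|)%N.
  by move=> /asboolP[u [ou Wu]]; apply: (sph_orthonormal_card ou) => i; exact: Wm.
case: (ex_maxnP P0 Pb) => k /asboolP[u [ou Wu]] kmax.
exists k, u; split => // p Wp x hx.
have Wsum : W (\sum_i I (p * u i) *: u i).
  elim/big_rec: _ => [//|i q _ Wq]; exact: Wlin.
have Wr : W (residual u p).
  by rewrite /residual addrC -scaleN1r; exact: Wlin.
have [r0|r0] := eqVneq (I (residual u p ^+ 2)) 0.
  have /eqP := sph_int_sqr_eq0 sigP r0 hx.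
  rewrite /residual mevalB subr_eq0 => /eqP ->.
  by rewrite raddf_sum/=; apply: eq_bigr => i _; rewrite mevalZ.
have rp : 0 < I (residual u p ^+ 2) by rewrite lt_neqAle eq_sym r0 sph_int_sqr_ge0.
suff /kmax : P k.+1 by rewrite ltnn.
pose c := (Num.sqrt (I (residual u p ^+ 2)))^-1.
pose v (i : 'I_k.+1) := if unlift ord0 i is Some j then u j else c *: residual u p.
apply/asboolP; exists v; split; last first.
  move=> i; rewrite /v; case: unliftP => [j _|_]; first exact: Wu.
  by rewrite -[_ *: _]addr0; exact: Wlin.
have vr j : I (c *: residual u p * u j) = 0.
  by rewrite -scalerAl linearZ/= residual_orth ?mulr0.
move=> i j; rewrite /v; case: unliftP => [i' ->|->]; case: unliftP => [j' ->|->].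
- by rewrite ou (inj_eq lift_inj).
- by rewrite mulrC vr eq_sym (negbTE (neq_lift _ _)).
- by rewrite vr (negbTE (neq_lift _ _)).
- rewrite eqxx -scalerAl -scalerAr !linearZ/= -expr2 mulrA -expr2 /c exprVn.
  by rewrite sqr_sqrtr ?mulVf// ltW.
Qed.

Lemma deg_le_comp_mx m (Q : 'M[R]_(d.+1)) (p : mp) : deg_le m p -> deg_le m (comp_mx Q p).
Proof.
move=> /deg_leP pm; rewrite /comp_mx comp_mpolyEX big_seq; apply: deg_le_sum => a ap.
apply/deg_leZ/(deg_le_trans (pm _ ap)); rewrite comp_mpolyX mdegE.
apply: deg_le_prod => i _; rewrite -[X in deg_le X]mul1n; apply: deg_leX.
by rewrite tnth_mktuple; apply: deg_le_sum => j _; apply/deg_leZ/deg_leXU.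
Qed.

Lemma deg_le_subspace m c (p q : mp) : deg_le m p -> deg_le m q -> deg_le m (c *: p + q).
Proof. by move=> hp hq; apply: deg_leD => //; exact: deg_leZ. Qed.

(* By the reproducing property, p = \sum_i u_i(Qx) (u_i o Q) gives K(Qx)^2 = p(x)^2 <= K(x) K(Qx)
   for the Christoffel function K = \sum_i u_i^2. *)
Lemma christoffel_const m k (u : 'I_k -> mp) : sph_orthonormal u ->
  (forall i, deg_le m (u i)) ->
  (forall p, deg_le m p -> forall x, sph x -> ev x p = \sum_i I (p * u i) * ev x (u i)) ->
  forall x, sph x -> \sum_i ev x (u i) ^+ 2 = k%:R.
Proof.
move=> ou um uE; pose K x := \sum_i ev x (u i) ^+ 2.
have K0 x : 0 <= K x by apply: sumr_ge0 => i _; exact: sqr_ge0.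
have KQ (Q : 'M[R]_(d.+1)) x : Q^T *m Q = 1%:M -> sph x -> K (act Q x) <= K x.
  move=> hQ hx; pose p : mp := \sum_i ev (act Q x) (u i) *: comp_mx Q (u i).
  have pm : deg_le m p.
    by apply: deg_le_sum => i _; apply/deg_leZ/deg_le_comp_mx.
  have px : ev x p = K (act Q x).
    rewrite raddf_sum/=; apply: eq_bigr => i _.
    by rewrite mevalZ meval_comp_mx expr2.
  have Ip : I (p ^+ 2) = K (act Q x).
    have cc i j : I (comp_mx Q (u i) * comp_mx Q (u j)) = (i == j)%:R.
      rewrite -ou -[RHS](sph_int_comp_mx sigP _ hQ); apply: eq_sph_int => y _.
      by rewrite mevalM !meval_comp_mx mevalM.
    rewrite expr2 mulr_suml raddf_sum/=; apply: eq_bigr => i _.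
    rewrite mulr_sumr raddf_sum/= (bigD1 i)//= -scalerAl -scalerAr !linearZ/= cc eqxx mulr1.
    rewrite big1 ?addr0 ?expr2// => j ji.
    by rewrite -scalerAl -scalerAr !linearZ/= cc eq_sym (negbTE ji) !mulr0.
  have : K (act Q x) ^+ 2 <= K (act Q x) * K x.
    rewrite -{1}px (uE _ pm _ hx); apply: (le_trans (cauchy_schwarz_sum _ _ _)).
    by apply: ler_wpM2r; [exact: K0|rewrite -Ip; exact: bessel].
  have [->//|n0] := eqVneq (K (act Q x)) 0.
  by rewrite expr2 ler_pM2l// lt_neqAle eq_sym n0 K0.
have Kxy x y : sph x -> sph y -> K x <= K y.
  move=> hx hy; have [Q hQ <-] := sphere_transitive hx hy; exact: KQ.
(* Being constant on the sphere, [K] equals its mean, and each [u i] contributes 1 to the mean. *)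
move=> x hx; rewrite -/(K x) -(sph_intC sigP (K x)).
rewrite (@eq_sph_int _ _ _ _ (\sum_i u i * u i)).
  by rewrite raddf_sum/= (eq_bigr (fun=> 1)) ?sumr_const ?card_ord// => i _; rewrite ou eqxx.
move=> y hy; rewrite mevalC raddf_sum/=; transitivity (K y).
  by apply/eqP; rewrite eq_le !Kxy.
by apply: eq_bigr => i _; rewrite mevalM expr2.
Qed.

(* The Lagrange polynomials of an M x ... x M grid, lifted to the sphere, are linearly independent. *)
Lemma dim_deg_le (M : nat) k (u : 'I_k -> mp) : (0 < d)%N -> (0 < M)%N ->
  (forall p, deg_le (d * M) p -> forall x, sph x -> ev x p = \sum_i I (p * u i) * ev x (u i)) ->
  (M ^ d <= k)%N.
Proof.
move=> d0 M0 uE.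
(* Grid coordinates lie in [[0, 1 / d]], so the sum of their [d] squares is at most 1 and a last
   coordinate completes them to a point of the sphere. *)
pose y (j : 'I_M) : R := j%:R / (M * d)%:R.
have Md0 : (M * d)%:R != 0 :> R by rewrite pnatr_eq0 -lt0n muln_gt0 M0 d0.
have y_inj i j : y i - y j == 0 -> i = j.
  rewrite subr_eq0 /y => /eqP /(divIf Md0)/eqP; rewrite eqr_nat => /eqP; exact: val_inj.
pose T := {ffun 'I_d -> 'I_M}.
have S1 (f : T) : \sum_i y (f i) ^+ 2 <= 1.
  apply: (@le_trans _ _ (\sum_(i < d) d%:R^-1)); last first.
    by rewrite sumr_const card_ord -[leLHS]mulr_natr mulVf// pnatr_eq0 -lt0n.
  apply: ler_sum => i _.
  have yd : y (f i) <= d%:R^-1.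
    rewrite /y natrM invfM mulrA ler_piMl ?invr_ge0// ler_pdivrMr ?ltr0n// mul1r ler_nat.
    exact: ltnW.
  have y0 : 0 <= y (f i) by rewrite divr_ge0.
  rewrite expr2; apply: le_trans (_ : y (f i) * 1 <= _); last by rewrite mulr1.
  by rewrite ler_wpM2l// (le_trans yd)// invf_le1 ?ltr0n// ler1n.
pose xf (f : T) : pt R d := [tuple
  if unlift ord_max k is Some i then y (f i) else Num.sqrt (1 - \sum_i y (f i) ^+ 2) | k < d.+1].
have xfE f i : tnth (xf f) (lift ord_max i) = y (f i) by rewrite tnth_mktuple liftK.
have xfs f : sph (xf f).
  rewrite /sphere/= big_ord_recr/= [X in _ + X ^+ 2](_ : _ = Num.sqrt (1 - \sum_i y (f i) ^+ 2)).
    rewrite sqr_sqrtr ?subr_ge0// [X in X + _](_ : _ = \sum_i y (f i) ^+ 2); first by rewrite addrC subrK.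
    apply: eq_bigr => i _; rewrite -xfE; congr (tnth _ _ ^+ 2).
    by apply: val_inj => /=; rewrite /bump leqNgt ltn_ord.
  by rewrite tnth_mktuple unlift_none.
pose L (f : T) : mp := \prod_(i < d) \prod_(j < M | j != f i)
  ((y (f i) - y j)^-1 *: ('X_(lift ord_max i) - mpolyC _ (y j))).
have Lm f : deg_le (d * M) (L f).
  have h : deg_le (\sum_(i < d) \sum_(j < M | j != f i) 1)%N (L f).
    apply: deg_le_prod => i _; apply: deg_le_prod => j _; apply/deg_leZ.
    by rewrite -mpolyCN; apply: deg_leD; [exact: deg_leXU|exact: deg_leC].
  apply: deg_le_trans h; apply: (@leq_trans (\sum_(i < d) M)).
    by apply: leq_sum => i _; rewrite sum1_card; apply: leq_trans (max_card _) _; rewrite card_ord.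
  by rewrite sum_nat_const card_ord.
have LE f g : ev (xf g) (L f) = (f == g)%:R.
  rewrite /L rmorph_prod/=; have [<-|fg] := eqVneq f g.
    apply: big1 => i _; rewrite rmorph_prod/=; apply: big1 => j ji.
    rewrite mevalZ mevalB mevalXU mevalC xfE mulVf//.
    by apply: contra ji => /y_inj ->.
  have [i fgi] : exists i, g i != f i.
    apply/existsP; rewrite -negb_forall; apply: contra fg => /forallP h.
    by apply/eqP/ffunP => i; rewrite (eqP (h i)).
  rewrite (bigD1 i)//= rmorph_prod/= (bigD1 (g i))//=.
  by rewrite mevalZ mevalB mevalXU mevalC xfE subrr mulr0 !mul0r.
pose N := #|{: T}|.
pose A := \matrix_(a < N, i < k) I (L (enum_val a) * u i).
pose B := \matrix_(i < k, b < N) ev (xf (enum_val b)) (u i).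
(* The identity of size [M ^ d] factors through dimension [k]. *)
have AB : A *m B = 1%:M.
  apply/matrixP => a b; rewrite !mxE -(inj_eq (@enum_val_inj _ _)) -LE.
  by rewrite (uE _ (Lm _) _ (xfs _)); apply: eq_bigr => i _; rewrite !mxE.
have -> : (M ^ d = N)%N by rewrite /N card_ffun !card_ord.
rewrite -(mxrank1 R N) -AB; apply: leq_trans (mxrankM_maxl _ _) _.
exact: rank_leq_col.
Qed.

End OrthonormalFamilies.

(** * Projections onto spherical harmonics *)

Section HarmonicProjections.
Variables (R : realType) (d : nat) (sig : probability (pt R d) R).
Hypothesis sigP : normalized_surface_measure R d sig.
Hypothesis d_gt0 : (0 < d)%N.
Local Notation sph := (sphere R d).
Local Notation mp := (mpoly d.+1 R).
Local Notation ev x p := (meval (tnth x) p).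
Local Notation I := (sph_int sig).
Local Notation harmonic := (harmonic_homog_poly R d).

Lemma harmonic_subspace l c (p q : mp) :
  harmonic l p -> harmonic l q -> harmonic l (c *: p + q).
Proof.
move=> [ph p0] [qh q0]; split.
  by have : c *: p + q \is @ishomog1 d.+1 R l mdeg by apply: rpredD => //; exact: rpredZ.
under eq_bigr do rewrite !(mderivD, mderivZ).
by rewrite big_split/= -scaler_sumr p0 q0 scaler0 addr0.
Qed.

Lemma harmonic_deg_le l (p : mp) : harmonic l p -> deg_le l p.
Proof. by move=> [/allP h _]; apply/deg_leP => m /h /eqP ->. Qed.

Lemma sph_int_mul_harmonic k l (p h : mp) : (k < l)%N -> deg_le k p ->
  harmonic l h -> I (p * h) = 0.
Proof. by move=> kl pk [hl h0]; exact: (sph_int_harmonic_deg sigP d_gt0 kl pk). Qed.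

Lemma sph_int_harmonic_neq k l (p q : mp) : k != l ->
  harmonic k p -> harmonic l q -> I (p * q) = 0.
Proof.
rewrite neq_ltn => /orP[kl|lk] hp hq.
  exact: (sph_int_mul_harmonic kl (harmonic_deg_le hp) hq).
by rewrite mulrC; exact: (sph_int_mul_harmonic lk (harmonic_deg_le hq) hp).
Qed.

(** Each projection is the expansion in an orthonormal basis of harmonics of that degree. The
    operators act on polynomials, so the quadrature argument never leaves polynomial algebra. *)
Lemma exists_harmonic_projection : exists H : nat -> mp -> mp,
  [/\ forall l p, harmonic l (H l p),
      forall l p h, harmonic l h -> I ((p - H l p) * h) = 0 &
      forall l, linear (H l)].
Proof.
have basis l : exists H : mp -> mp, [/\ forall p, harmonic l (H p),
    forall p h, harmonic l h -> I ((p - H p) * h) = 0 & linear H].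
  have W0 : harmonic l (0 : mp).
    by split; [rewrite msupp0|rewrite big1// => i _; rewrite !mderiv0].
  have [k [u [ou Wu uE]]] := exists_orthonormal_basis sigP
    (@harmonic_subspace l) W0 (@harmonic_deg_le l).
  exists (fun p => \sum_i I (p * u i) *: u i); split.
  - move=> p; elim/big_rec: _ => [//|i q _ Wq]; exact: harmonic_subspace.
  - move=> p h hh; rewrite -/(residual sig u p).
    rewrite (@eq_sph_int _ _ _ _ (residual sig u p * \sum_i I (h * u i) *: u i)).
      rewrite mulr_sumr raddf_sum/= big1// => i _.
      by rewrite -scalerAr linearZ/= residual_orth ?mulr0.
    move=> x hx; rewrite !mevalM (uE _ hh _ hx) raddf_sum/=; congr (_ * _).
    by apply: eq_bigr => i _; rewrite mevalZ.
  - move=> c p q; rewrite scaler_sumr -big_split/=; apply: eq_bigr => i _.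
    by rewrite mulrDl raddfD/= -scalerAl linearZ/= scalerDl scalerA.
have [H HP] := choice basis.
by exists H; split => l; case: (HP l).
Qed.

Variable H : nat -> mp -> mp.
Hypothesis H_harmonic : forall l p, harmonic l (H l p).
Hypothesis H_orth : forall l p h, harmonic l h -> I ((p - H l p) * h) = 0.

Lemma sph_int_mul_proj l p : I (p * H l p) = I (H l p ^+ 2).
Proof.
apply/eqP; rewrite -subr_eq0 expr2 -raddfB/= -mulrBl; apply/eqP.
exact: H_orth.
Qed.

Lemma proj_deg_eq0 k l p : (k < l)%N -> deg_le k p -> I (H l p ^+ 2) = 0.
Proof.
by move=> kl pk; rewrite -sph_int_mul_proj (sph_int_mul_harmonic kl pk).
Qed.

(** The sum [g] of the projections satisfies [I (p * g) = I (g * g)], so the difference of the two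
    sides is the integral of [(p - g) ^+ 2]. *)
Lemma proj_bessel L p : \sum_(l < L) I (H l p ^+ 2) <= I (p ^+ 2).
Proof.
pose g := \sum_(l < L) H l p; pose s := \sum_(l < L) I (H l p ^+ 2).
have pg : I (p * g) = s.
  by rewrite mulr_sumr raddf_sum/=; apply: eq_bigr => l _; exact: sph_int_mul_proj.
have gg : I (g * g) = s.
  rewrite mulr_suml raddf_sum/=; apply: eq_bigr => l _.
  rewrite mulr_sumr raddf_sum/= (bigD1 l)//= -expr2 big1 ?addr0// => k kl.
  by apply: (sph_int_harmonic_neq _ (H_harmonic _ _) (H_harmonic _ _)); rewrite eq_sym.
rewrite -subr_ge0 -/s.
have -> : I (p ^+ 2) - s = I ((p - g) ^+ 2).
  have -> : (p - g) ^+ 2 = p ^+ 2 - p * g - (p * g - g * g) by ring.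
  by rewrite raddfB/= raddfB/= raddfB/= pg gg subrr subr0.
exact: sph_int_sqr_ge0.
Qed.

Lemma is_proj_harm_poly l p :
  is_proj_harm R d sig l (fun x => ev x p) (fun x => ev x (H l p)).
Proof.
split; first by exists (H l p); split.
move=> h [q [qh hq]]; rewrite -[RHS]/(0%:E) -(H_orth p qh) -sph_intE.
by apply: eq_integral => x /set_mem hx; rewrite hq// mevalM mevalB.
Qed.

End HarmonicProjections.

(** * Orthogonal projection onto a row space *)

Section RowProjector.
Variable R : realFieldType.

(** If [v] is in the kernel of the Gram matrix, then [v *m B] has norm zero. *)
Lemma mulmx_tr_unit k m (B : 'M[R]_(k, m)) : row_free B -> B *m B^T \in unitmx.
Proof.
move=> fB; rewrite -row_free_unit; apply/inj_row_free => v vB.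
suff /eqP : v *m B = 0 by rewrite mulmx_free_eq0// => /eqP.
apply/rowP => j; rewrite [RHS]mxE.
have : (v *m B *m (v *m B)^T) 0 0 = 0 by rewrite trmx_mul !mulmxA -[v *m B *m _]mulmxA vB mul0mx mxE.
rewrite mxE; under eq_bigr do rewrite [X in _ * X]mxE -expr2.
move=> /eqP; rewrite psumr_eq0 => [|i _]; last exact: sqr_ge0.
by move=> /allP/(_ j); rewrite mem_index_enum sqrf_eq0 => /(_ isT)/eqP.
Qed.

(** For a row basis [B] of [A], the projector is [B^T *m invmx (B *m B^T) *m B]; its trace is the
    rank of [A]. *)
Lemma exists_row_projector n m (A : 'M[R]_(n, m)) : exists Q : 'M[R]_m,
  [/\ Q^T = Q, Q *m Q = Q, A *m Q = A & \tr Q <= n%:R].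
Proof.
have [k [B [D [kn fB AD]]]] : exists k (B : 'M[R]_(k, m)) (D : 'M[R]_(n, k)),
    [/\ (k <= n)%N, row_free B & A = D *m B].
  have /submxP[D AD] : (A <= row_base A)%MS by rewrite eq_row_base.
  by exists (\rank A), (row_base A), D; split; [exact: rank_leq_row|exact: row_base_free|].
have uB := mulmx_tr_unit fB.
have [C CT BC] : exists2 C, C^T = C & B *m B^T *m C = 1%:M.
  exists (invmx (B *m B^T)); last exact: mulmxV.
  by rewrite trmx_inv trmx_mul trmxK.
exists (B^T *m C *m B); split.
- by rewrite trmx_mul trmx_mul trmxK CT mulmxA.
- by rewrite !mulmxA -[_ *m B *m B^T]mulmxA -[_ *m (B *m B^T) *m C]mulmxA BC mulmx1.
- by rewrite AD !mulmxA -[D *m B *m _]mulmxA -[_ *m (B *m B^T) *m C]mulmxA BC mulmx1.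
- by rewrite mxtrace_mulC mulmxA BC mxtrace1 ler_nat.
Qed.

End RowProjector.

(** * Multiscale features and the fooling polynomial *)

Section Fooling.
Variables (R : realType) (d : nat) (sig : probability (pt R d) R).
Hypothesis sigP : normalized_surface_measure R d sig.
Hypothesis d_gt0 : (0 < d)%N.
Local Notation sph := (sphere R d).
Local Notation mp := (mpoly d.+1 R).
Local Notation ev x p := (meval (tnth x) p).
Local Notation I := (sph_int sig).

(* An orthonormal basis of the polynomials of degree at most d 2^(S+r), of dimension at least
   2^(d(S+r)), for each r < S, all scaled so that the squares of all members add up to 1. *)
Lemma exists_multiscale_features (S : nat) : (0 < S)%N ->
  exists N (phi : 'I_N -> mp) (rho : 'I_N -> 'I_S),
  [/\ forall a, deg_le (d * 2 ^ (S + rho a)) (phi a),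
      forall a b, a != b -> rho a = rho b -> I (phi a * phi b) = 0,
      forall a, I (phi a ^+ 2) <= (S%:R * 2 ^+ (d * (S + rho a)))^-1 &
      forall x, sph x -> \sum_a ev x (phi a) ^+ 2 = 1].
Proof.
move=> S0.
have basis (r : 'I_S) : exists ku : {k : nat & 'I_k -> mp},
   [/\ sph_orthonormal sig (projT2 ku), forall i, deg_le (d * 2 ^ (S + r)) (projT2 ku i),
       (2 ^ (d * (S + r)) <= projT1 ku)%N &
       forall x, sph x -> \sum_i ev x (projT2 ku i) ^+ 2 = (projT1 ku)%:R].
  have [k [u [ou um uE]]] := exists_orthonormal_basis sigP
    (@deg_le_subspace R d (d * 2 ^ (S + r))) (deg_le0 _ _ _) (fun p h => h).
  exists (existT _ k u); split => //=.
    rewrite mulnC expnM; apply: (dim_deg_le d_gt0 _ uE); exact: expn_gt0.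
  by move=> x hx; exact: (christoffel_const sigP ou um uE).
have [ku kuP] := choice basis.
pose k r := projT1 (ku r); pose u r : 'I_(k r) -> mp := projT2 (ku r).
pose J := {r : 'I_S & 'I_(k r)}.
(* The squares of an orthonormal basis add up to [k r], so with this factor every scale contributes
   [1 / S]. *)
pose c r : R := (Num.sqrt (S%:R * (k r)%:R))^-1.
have Sk r : 0 < S%:R * (k r)%:R :> R.
  have [_ _ h _] := kuP r.
  by rewrite mulr_gt0 ?ltr0n//; apply: leq_trans h; exact: expn_gt0.
have cc r : c r ^+ 2 = (S%:R * (k r)%:R)^-1.
  by rewrite /c exprVn sqr_sqrtr// ltW.
pose psi (j : J) : mp := c (tag j) *: u (tag j) (tagged j).
exists #|{: J}|, (fun a => psi (enum_val a)), (fun a => tag (enum_val a)); split.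
- move=> a; apply: deg_leZ; have [_ h _ _] := kuP (tag (enum_val a)); exact: h.
- move=> a b ab; have : enum_val a != enum_val b by rewrite (inj_eq enum_val_inj).
  rewrite /psi; move: (enum_val a) (enum_val b) => [r i] [s j] /= ij rs.
  case: s / rs j ij => j ij; rewrite -scalerAl -scalerAr !linearZ/=.
  have [-> _ _ _] := kuP r.
  by move: ij; rewrite eq_Tagged/= => /negbTE ->; rewrite !mulr0.
- move=> a; rewrite /psi; move: (tag _) (tagged _) => r i.
  rewrite exprZn linearZ/= cc expr2; have [-> _ h _] := kuP r.
  rewrite eqxx mulr1 lef_pV2 ?posrE//; last by rewrite mulr_gt0 ?ltr0n// exprn_gt0.
  by rewrite ler_pM2l ?ltr0n// -natrX ler_nat.
- move=> x hx; transitivity (\sum_(j : J) ev x (psi j) ^+ 2).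
    by rewrite [RHS](reindex (enum_val (A := {: J})))//=; exact/onW_bij/enum_val_bij.
  rewrite -(sig_big_dep xpredT (fun _ _ => true) (fun r i => ev x (c r *: u r i) ^+ 2))/=.
  rewrite (eq_bigr (fun=> S%:R^-1)).
    by rewrite sumr_const card_ord -[LHS]mulr_natr mulVf// pnatr_eq0 -lt0n.
  move=> r _; under eq_bigr do rewrite mevalZ exprMn.
  rewrite -mulr_sumr cc; have [_ _ _ ->//] := kuP r.
  have k0 : (k r)%:R != 0 :> R by apply: contraTneq (Sk r) => ->; rewrite mulr0 ltxx.
  by rewrite invfM -mulrA mulVf// mulr1.
Qed.

Lemma fooling_polynomial (S n : nat) (X : 'I_n -> pt R d) : (0 < S)%N ->
  (2 * n <= 2 ^ (d * S))%N -> (forall j, sph (X j)) ->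
  exists (F : mp) (G : 'I_S -> mp),
  [/\ forall j, ev (X j) F = 0, 1 / 2 <= I F,
      forall x, sph x -> 0 <= ev x F <= 1 /\ ev x F = 1 - \sum_r ev x (G r),
      forall r : 'I_S, deg_le (2 * (d * 2 ^ (S + r))) (G r) &
      \sum_(r < S) 2 ^+ (d * (S + r)) * I (G r ^+ 2) <= 4 * n%:R / S%:R].
Proof.
move=> S0 n2 hX.
have [N [phi [rho [phi_deg phi_orth phi_sqr phi1]]]] := exists_multiscale_features S0.
have [Q [QT QQ AQ Qn]] := exists_row_projector (\matrix_(j < n, a < N) ev (X j) (phi a)).
have Qsym a b : Q a b = Q b a by rewrite -{1}QT mxE.
have QQE a b : \sum_c Q a c * Q c b = Q a b by rewrite -{3}QQ mxE.
(* The squared Frobenius norm of a symmetric projector is its trace. *)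
have Qsqr : \sum_a \sum_b Q a b ^+ 2 <= n%:R.
  apply: le_trans Qn; rewrite le_eqVlt; apply/orP; left; apply/eqP.
  by apply: eq_bigr => a _; rewrite -QQE; apply: eq_bigr => b _; rewrite expr2 {2}Qsym.
pose w (r : 'I_S) : R := (S%:R * 2 ^+ (d * (S + r)))^-1.
have w0 r : 0 <= w r by rewrite invr_ge0 mulr_ge0// exprn_ge0.
(* Features of the same scale are orthogonal with squared norms at most [w r]; nothing is known
   across scales. *)
have block (c : 'I_N -> R) r : I ((\sum_(a | rho a == r) c a *: phi a) ^+ 2) <=
    w r * \sum_(a | rho a == r) c a ^+ 2.
  rewrite expr2 mulr_suml raddf_sum/= mulr_sumr; apply: ler_sum => a /eqP ar.
  rewrite mulr_sumr raddf_sum/= (bigD1 a) ?ar//= big1 ?addr0 => [|b /andP[/eqP br ba]].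
    rewrite -scalerAl -scalerAr !linearZ/= mulrA -!expr2 mulrC.
    by rewrite ler_wpM2r ?sqr_ge0// /w -ar.
  by rewrite -scalerAl -scalerAr !linearZ/= phi_orth ?mulr0// ?ar ?br// eq_sym.
pose v b : mp := \sum_a Q a b *: phi a.
have evv x b : ev x (v b) = \sum_a Q a b * ev x (phi a).
  by rewrite raddf_sum/=; apply: eq_bigr => a _; rewrite mevalZ.
have evQ x : \sum_b ev x (v b) ^+ 2 = \sum_a \sum_b Q a b * (ev x (phi a) * ev x (phi b)).
  transitivity (\sum_b \sum_a \sum_c (Q a b * Q b c) * (ev x (phi a) * ev x (phi c))).
    apply: eq_bigr => b _; rewrite evv expr2 mulr_suml; apply: eq_bigr => a _.
    by rewrite mulr_sumr; apply: eq_bigr => c _; rewrite (Qsym c b); ring.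
  rewrite exchange_big/=; apply: eq_bigr => a _; rewrite exchange_big/=; apply: eq_bigr => c _.
  by rewrite -mulr_suml QQE.
(* The first sum is 1 on the sphere, and [v b] is the coordinate [b] of the projected feature
   vector. *)
pose F : mp := \sum_a phi a ^+ 2 - \sum_b v b ^+ 2.
have FE x : sph x -> ev x F = 1 - \sum_b ev x (v b) ^+ 2.
  move=> hx; rewrite /F mevalB -(phi1 x hx).
  by congr (_ - _); rewrite raddf_sum/=; apply: eq_bigr => a _; rewrite rmorphXn.
(* Multiplicity of the product of [phi b] with a feature of scale [r]: the off-diagonal pairs of
   scales are counted twice at the larger scale and never at the smaller one. *)
pose m (b : 'I_N) (r : 'I_S) : R := if (rho b < r)%N then 2 else if rho b == r then 1 else 0.
have m2 b r : m b r ^+ 2 <= 4.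
  by rewrite /m; case: ifP => _; [|case: ifP => _]; rewrite ?expr0n/=; lra.
pose y r b : mp := \sum_(a | rho a == r) (m b r * Q a b) *: phi a.
pose G r : mp := \sum_b phi b * y r b.
exists F, G; split.
- move=> j; rewrite FE// -(phi1 (X j))//; apply/eqP; rewrite subr_eq0; apply/eqP.
  apply: eq_bigr => b _; congr (_ ^+ 2); rewrite evv.
  move/matrixP: AQ => /(_ j b); rewrite !mxE => <-.
  by apply: eq_bigr => a _; rewrite mxE mulrC.
(* Splitting [v b] into its [S] scales costs a factor [S], which the [1 / S] in [w r] cancels.
   Summed over [b], this leaves [n / 2 ^+ (d * S)], at most one half. *)
- have vE b : I (v b ^+ 2) <= (2 ^+ (d * S))^-1 * \sum_a Q a b ^+ 2.
    have -> : v b = \sum_r \sum_(a | rho a == r) Q a b *: phi a.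
      exact: (partition_big rho xpredT).
    set z := fun r : 'I_S => \sum_(a | rho a == r) Q a b *: phi a.
    apply: (@le_trans _ _ (I (S%:R *: \sum_r z r ^+ 2))).
      apply: le_sph_int => x _; rewrite mevalZ rmorphXn/= !raddf_sum/=.
      under [X in _ <= _ * X]eq_bigr do rewrite rmorphXn.
      by apply: (le_trans (sqr_sum_le _)); rewrite card_ord.
    rewrite linearZ/= raddf_sum/= (partition_big rho xpredT)//= !mulr_sumr.
    apply: ler_sum => r _.
    apply: (@le_trans _ _ (S%:R * (w r * \sum_(a | rho a == r) Q a b ^+ 2))).
      by rewrite ler_wpM2l//; exact: block.
    rewrite mulrA ler_wpM2r//; first by apply: sumr_ge0 => a _; exact: sqr_ge0.
    rewrite /w invfM mulrA mulfV ?pnatr_eq0 -?lt0n// mul1r lef_pV2 ?posrE ?exprn_gt0//.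
    by rewrite ler_eXn2l ?ltr1n// leq_mul2l leq_addr orbT.
  have -> : I F = 1 - \sum_b I (v b ^+ 2).
    rewrite -(sph_int1 sigP) -raddf_sum -raddfB/=; apply: eq_sph_int => x hx.
    rewrite FE// mevalB meval1; congr (_ - _); rewrite raddf_sum/=; apply: eq_bigr => b _.
    by rewrite rmorphXn.
  have : \sum_b I (v b ^+ 2) <= (2 ^+ (d * S))^-1 * n%:R.
    apply: (@le_trans _ _ (\sum_b (2 ^+ (d * S))^-1 * \sum_a Q a b ^+ 2)).
      by apply: ler_sum => b _; exact: vE.
    rewrite -mulr_sumr ler_wpM2l ?invr_ge0 ?exprn_ge0//.
    by rewrite exchange_big.
  have : (2 ^+ (d * S))^-1 * n%:R <= 1 / 2 :> R.
    rewrite mulrC ler_pdivrMr ?exprn_gt0// mulrAC mul1r ler_pdivlMr// mulrC.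
    by rewrite -natrX -natrM ler_nat.
  by lra.
- move=> x hx; have E : ev x F = 1 - \sum_r ev x (G r).
    rewrite FE// evQ; congr (_ - _).
    have GE r : ev x (G r) = \sum_(a | rho a == r) \sum_b m b r * (Q a b * (ev x (phi a) * ev x (phi b))).
      rewrite raddf_sum/= exchange_big/=; apply: eq_bigr => b _.
      rewrite mevalM raddf_sum/= mulr_sumr; apply: eq_bigr => a _.
      by rewrite mevalZ; ring.
    under [RHS]eq_bigr do rewrite GE.
    have -> : \sum_r \sum_(a | rho a == r) \sum_b m b r * (Q a b * (ev x (phi a) * ev x (phi b))) =
        \sum_a \sum_b m b (rho a) * (Q a b * (ev x (phi a) * ev x (phi b))).
      rewrite [RHS](partition_big rho xpredT)//=; apply: eq_bigr => r _.
      by apply: eq_bigr => a /eqP ->.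
    pose T a b := Q a b * (ev x (phi a) * ev x (phi b)).
    have TC a b : T a b = T b a by rewrite /T Qsym; ring.
    (* The multiplicities of [(a, b)] and [(b, a)] add up to 2 and [T] is symmetric, so the weighted
       double sum equals the plain one. *)
    have mm a b : m b (rho a) + m a (rho b) = 2.
      rewrite /m -!(inj_eq val_inj)/= [rho b == rho a :> nat]eq_sym.
      by case: ltngtP => _ /=; rewrite ?addr0 ?add0r.
    have e1 : \sum_a \sum_b m b (rho a) * T a b = \sum_a \sum_b m a (rho b) * T a b.
      by rewrite exchange_big/=; apply: eq_bigr => a _; apply: eq_bigr => b _; rewrite TC.
    have e2 : \sum_a \sum_b m b (rho a) * T a b + \sum_a \sum_b m a (rho b) * T a b =
        2 * \sum_a \sum_b T a b.
      rewrite -big_split mulr_sumr; apply: eq_bigr => a _; rewrite -big_split mulr_sumr.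
      by apply: eq_bigr => b _; rewrite /= -mulrDl mm.
    rewrite -[LHS]/(\sum_a \sum_b T a b) -[RHS]/(\sum_a \sum_b m b (rho a) * T a b).
    by move: e2; rewrite -e1; lra.
  split => //; rewrite FE// lerBlDr lerDl subr_ge0; apply/andP; split; last first.
    by apply: sumr_ge0 => b _; exact: sqr_ge0.
  set s := \sum_b _.
  have s0 : 0 <= s by apply: sumr_ge0 => b _; exact: sqr_ge0.
  (* [s] is also the inner product of the feature vector with its projection, so Cauchy-Schwarz
     applies; [s <= 1] follows. *)
  have : s ^+ 2 <= s * 1.
    rewrite -(phi1 x hx); apply: le_trans (cauchy_schwarz_sum _ _ _).
    rewrite le_eqVlt; apply/orP; left; apply/eqP; congr (_ ^+ 2).
    rewrite /s evQ exchange_big/=; apply: eq_bigr => b _; rewrite evv mulr_suml.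
    by apply: eq_bigr => a _; ring.
  by have [->//|sn0] := eqVneq s 0; rewrite expr2 ler_pM2l// lt_neqAle eq_sym sn0 s0.
- move=> r; apply: deg_le_sum => b _; rewrite /y /m mulr_sumr; apply: deg_le_sum => a /eqP ar.
  case: ifPn => br; last first.
    case: ifPn => [/eqP br'|_]; last by rewrite mul0r scale0r mulr0 deg_le0.
    by rewrite -scalerAr; apply: deg_leZ; rewrite mul2n -addnn -{1}br' -ar; exact: deg_leM.
  rewrite -scalerAr; apply: deg_leZ; rewrite mul2n -addnn -{2}ar; apply: deg_leM => //.
  apply: deg_le_trans (phi_deg b); rewrite leq_mul2l leq_exp2l// leq_add2l (ltnW br) orbT.
  by [].
(* Cauchy-Schwarz in [b] at each point, where the squares of the features add up to 1, followed by
   [block] for each [y r b]. *)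
- have GE r : I (G r ^+ 2) <= 4 * w r * \sum_(a | rho a == r) \sum_b Q a b ^+ 2.
    apply: (@le_trans _ _ (I (\sum_b y r b ^+ 2))).
      apply: le_sph_int => x hx; rewrite rmorphXn/= !raddf_sum/=.
      have := cauchy_schwarz_sum xpredT (fun b => ev x (phi b)) (fun b => ev x (y r b)).
      rewrite (phi1 x hx) mul1r.
      under [X in X ^+ 2 <= _ -> _]eq_bigr do rewrite -mevalM.
      by move/le_trans; apply; apply: ler_sum => b _; rewrite rmorphXn.
    rewrite raddf_sum/= exchange_big/= mulr_sumr; apply: ler_sum => b _.
    apply: (le_trans (block _ _)); rewrite [4 * _]mulrC -mulrA ler_wpM2l//.
    rewrite mulr_sumr; apply: ler_sum => a _.
    by rewrite exprMn ler_wpM2r// sqr_ge0.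
  apply: (@le_trans _ _ (\sum_r (4 / S%:R) * \sum_(a | rho a == r) \sum_b Q a b ^+ 2)).
    apply: ler_sum => r _; apply: (le_trans (ler_wpM2l _ (GE r))); first by rewrite exprn_ge0.
    rewrite mulrA ler_wpM2r//.
      by apply: sumr_ge0 => a _; apply: sumr_ge0 => b _; exact: sqr_ge0.
    rewrite le_eqVlt; apply/orP; left; apply/eqP; rewrite /w; field.
    by rewrite pnatr_eq0 -lt0n S0 expf_neq0// pnatr_eq0.
  rewrite -mulr_sumr [leRHS]mulrAC ler_wpM2l ?divr_ge0//.
  by apply: le_trans Qsqr; rewrite [leRHS](partition_big rho xpredT).
Qed.

End Fooling.

(** * Geometric sums and bounds for the Sobolev weights *)

Section Weights.
Variable R : realType.

Lemma weighted_sqr_sum_le (T : finType) (P : pred T) (w f : T -> R) :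
  (forall i, 0 < w i) ->
  (\sum_(i | P i) f i) ^+ 2 <= (\sum_(i | P i) (w i)^-1) * \sum_(i | P i) w i * f i ^+ 2.
Proof.
move=> w0; have ww i : Num.sqrt (w i) ^+ 2 = w i by rewrite sqr_sqrtr// ltW.
have := cauchy_schwarz_sum P (fun i => (Num.sqrt (w i))^-1) (fun i => Num.sqrt (w i) * f i).
have -> : \sum_(i | P i) (Num.sqrt (w i))^-1 * (Num.sqrt (w i) * f i) = \sum_(i | P i) f i.
  by apply: eq_bigr => i _; rewrite mulKf// gt_eqF// sqrtr_gt0.
have -> : \sum_(i | P i) (Num.sqrt (w i))^-1 ^+ 2 = \sum_(i | P i) (w i)^-1.
  by apply: eq_bigr => i _; rewrite exprVn ww.
have -> // : \sum_(i | P i) (Num.sqrt (w i) * f i) ^+ 2 = \sum_(i | P i) w i * f i ^+ 2.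
by apply: eq_bigr => i _; rewrite exprMn ww.
Qed.

(** A geometric series is at most twice its largest term, here the inverse of a power of two that is
    at least [y]. *)
Lemma pow2_tail_sum (y : R) (T : nat) : 0 < y ->
  \sum_(r < T | y <= 2 ^+ r) (2 ^+ r)^-1 <= 2 / y.
Proof.
move=> y0.
(* The added term is the whole geometric tail from [T] on; carrying it closes the induction. *)
suff : \sum_(r < T | y <= 2 ^+ r) (2 ^+ r)^-1 +
    (if y <= 2 ^+ T then 2 * (2 ^+ T)^-1 else 0) <= 2 / y.
  by apply: le_trans; rewrite lerDl; case: ifP => // _; rewrite mulr_ge0// invr_ge0 exprn_ge0.
elim: T => [|T IH].
  rewrite big_ord0 add0r expr0; case: ifP => y1; last by rewrite divr_ge0// ltW.
  by rewrite ler_pM2l// lef_pV2 ?posrE.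
rewrite big_mkcond big_ord_recr/= -big_mkcond/=.
have p0 : 0 < 2 ^+ T :> R by rewrite exprn_gt0.
have e : 2 * (2 ^+ T.+1)^-1 = (2 ^+ T)^-1 :> R by rewrite exprS invfM mulrA mulfV ?mul1r.
rewrite e; move: IH; have [yT|yT] := leP y (2 ^+ T).
  have -> : y <= 2 ^+ T.+1 by apply: (le_trans yT); rewrite exprS; lra.
  lra.
rewrite addr0 big1 => [_|r yr]; last first.
  by move: (lt_le_trans yT yr); rewrite ltr_eXn2l ?ltr1n// ltnNge (ltnW (ltn_ord r)).
rewrite add0r; case: ifP => yT1; last by rewrite divr_ge0// ltW.
by rewrite -e ler_pM2l// lef_pV2 ?posrE ?exprn_gt0.
Qed.

Lemma lambda_ab_invsqr (d : nat) (beta : R) (l : nat) :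
  (lambda_ab R d (d%:R / 2) beta l) ^- 2 =
  ((1 + l%:R * (l%:R + d%:R - 1)) `^ (d%:R / 2 / 2)) ^+ 2 *
  ((ln (3 + l%:R * (l%:R + d%:R - 1))) `^ beta) ^+ 2.
Proof. by rewrite /lambda_ab !powRN -invfM exprVn invrK exprMn. Qed.

(** The eigenvalue [t] is at most [d * l ^ 2], so the power part is of order [l ^ d]. The degree
    bound gives [3 + t <= K ^+ S], so the logarithm is at most [S * ln K]. *)
Lemma lambda_ab_bound (d : nat) (beta : R) : (0 < d)%N -> 0 <= beta ->
  exists2 D : R, 0 < D & forall S l : nat, (0 < S)%N -> (0 < l)%N ->
    (l <= 2 * (d * 2 ^ (S + S)))%N ->
    (lambda_ab R d (d%:R / 2) beta l) ^- 2 <= D * (S%:R `^ beta) ^+ 2 * l%:R ^+ d.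
Proof.
move=> d0 b0.
pose K : R := (d%:R + 3) * (2 * d%:R) ^+ 2 * 16.
have dR : 1 <= d%:R :> R by rewrite ler1n.
have K1 : 1 < K.
  rewrite /K; apply: (@lt_le_trans _ _ (1 * 1 * 16)); first by lra.
  rewrite ler_pM// ler_pM//; first by lra.
  by rewrite expr_ge1//; lra.
exists ((d.+1%:R ^+ d) * (ln K `^ beta) ^+ 2).
  by rewrite mulr_gt0 ?exprn_gt0 ?powR_gt0 ?ln_gt0.
move=> S l S0 l0 lS; rewrite lambda_ab_invsqr.
have lR : 1 <= l%:R :> R by rewrite ler1n.
set t := l%:R * _; have t0 : 0 <= t by rewrite mulr_ge0//; lra.
have tl : t <= d%:R * l%:R ^+ 2.
  rewrite /t expr2 mulrCA ler_wpM2l ?(le_trans ler01)//.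
  have : 0 <= (d%:R - 1) * (l%:R - 1) :> R by rewrite mulr_ge0 ?subr_ge0.
  by lra.
have dE : d.+1%:R = d%:R + 1 :> R by rewrite -natr1.
have A : ((1 + t) `^ (d%:R / 2 / 2)) ^+ 2 <= d.+1%:R ^+ d * l%:R ^+ d.
  have -> : d.+1%:R ^+ d * l%:R ^+ d = (((d.+1%:R * l%:R) ^+ 2) `^ (d%:R / 2 / 2)) ^+ 2 :> R.
    have y0 : 0 <= d.+1%:R * l%:R :> R by rewrite mulr_ge0.
    rewrite -exprMn -!powR_mulrn ?powR_ge0// -!powRrM; congr (_ `^ _); by field.
  rewrite ler_pXn2r ?nnegrE ?powR_ge0//; apply: ge0_ler_powR; rewrite ?nnegrE ?sqr_ge0//; first lra.
  have l2 : 1 <= l%:R ^+ 2 :> R by rewrite expr_ge1// (le_trans ler01).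
  rewrite dE exprMn; move: tl l2; set q := _ ^+ 2 => tl q1.
  have : 0 <= (d%:R ^+ 2 + d%:R) * q by rewrite mulr_ge0 ?addr_ge0 ?sqr_ge0// (le_trans ler01).
  by lra.
have B : (ln (3 + t) `^ beta) ^+ 2 <= (S%:R `^ beta) ^+ 2 * (ln K `^ beta) ^+ 2.
  rewrite -exprMn -powRM ?ln_ge0 ?(ltW K1)//.
  rewrite ler_pXn2r ?nnegrE ?powR_ge0//.
  apply: ge0_ler_powR; rewrite ?nnegrE//.
  - by rewrite ln_ge0//; lra.
  - by rewrite mulr_ge0 ?ln_ge0// ltW.
  rewrite mulr_natl -lnXn; last by lra.
  rewrite ler_ln ?posrE; [|lra|by rewrite exprn_gt0//; lra].
  have lS' : l%:R <= 2 * d%:R * 4 ^+ S :> R.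
    move: lS; rewrite -(ler_nat R) !natrM natrX addnn -mul2n exprM => h.
    by apply: (le_trans h); rewrite mulrA -natrX.
  apply: (@le_trans _ _ ((d%:R + 3) * (2 * d%:R) ^+ 2 * 16 ^+ S)).
    have -> : (16 : R) = 4 ^+ 2 by rewrite -natrX.
    rewrite -exprM mulnC exprM -mulrA -exprMn.
    apply: (@le_trans _ _ ((d%:R + 3) * l%:R ^+ 2)); first by nra.
    rewrite ler_pM2l; last by lra.
    by rewrite ler_pXn2r// ?nnegrE// mulr_ge0// ?exprn_ge0//; lra.
  rewrite /K [leRHS]exprMn ler_wpM2r ?exprn_ge0//.
  rewrite ler_eXnr// -[1](mulr1 1) ler_pM//; first by lra.
  by rewrite expr_ge1//; lra.
rewrite [leRHS](_ : _ = (d.+1%:R ^+ d * l%:R ^+ d) * ((S%:R `^ beta) ^+ 2 * (ln K `^ beta) ^+ 2)).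
  by apply: ler_pM => //; exact: sqr_ge0.
by ring.
Qed.

End Weights.

(** * Sobolev energy of the fooling polynomial *)

Section Energy.
Variables (R : realType) (d : nat) (sig : probability (pt R d) R).
Hypothesis sigP : normalized_surface_measure R d sig.
Hypothesis d_gt0 : (0 < d)%N.
Local Notation sph := (sphere R d).
Local Notation mp := (mpoly d.+1 R).
Local Notation ev x p := (meval (tnth x) p).
Local Notation I := (sph_int sig).
Local Notation harmonic := (harmonic_homog_poly R d).

Variable H : nat -> mp -> mp.
Hypothesis H_harmonic : forall l p, harmonic l (H l p).
Hypothesis H_orth : forall l p h, harmonic l h -> I ((p - H l p) * h) = 0.
Hypothesis H_linear : forall l, linear (H l).

Lemma proj_sub_sum l (p : mp) (S : nat) (G : 'I_S -> mp) :
  H l (p - \sum_r G r) = H l p - \sum_r H l (G r).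
Proof.
have HD p1 p2 : H l (p1 + p2) = H l p1 + H l p2.
  by rewrite -[p1]scale1r H_linear !scale1r.
have H0 : H l 0 = 0 by apply: (addrI (H l 0)); rewrite -HD !addr0.
rewrite addrC -scaleN1r H_linear scaleN1r addrC; congr (_ - _).
exact: (big_morph (H l) HD H0).
Qed.

(** For [l > 0] the constant projects to zero on the sphere, and so does every scale of degree below
    [l]. Cauchy-Schwarz with weights [2 ^+ (S + r)] over the remaining scales is the Hardy-type
    step. *)
Lemma proj_energy_le l (S : nat) (G : 'I_S -> mp) : (0 < l)%N ->
  (forall r : 'I_S, deg_le (2 * (d * 2 ^ (S + r))) (G r)) ->
  I (H l (1 - \sum_r G r) ^+ 2) <=
  4 * d%:R / l%:R * \sum_(r < S | (l <= 2 * (d * 2 ^ (S + r)))%N) 2 ^+ (S + r) * I (H l (G r) ^+ 2).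
Proof.
move=> l0 Gdeg; rewrite proj_sub_sum.
have one0 x : sph x -> ev x (H l 1) = 0.
  apply: (sph_int_sqr_eq0 sigP); apply: (proj_deg_eq0 sigP d_gt0 H_harmonic H_orth l0).
  by rewrite -(mpolyC1 d.+1 R); exact: deg_leC.
pose P (r : 'I_S) := (l <= 2 * (d * 2 ^ (S + r)))%N.
have out0 r x : ~~ P r -> sph x -> ev x (H l (G r)) = 0.
  rewrite -ltnNge => lr; apply: (sph_int_sqr_eq0 sigP).
  exact: (proj_deg_eq0 sigP d_gt0 H_harmonic H_orth lr (Gdeg r)).
pose w (r : 'I_S) : R := 2 ^+ (S + r).
have w0 r : 0 < w r by rewrite exprn_gt0.
pose W := \sum_(r | P r) (w r)^-1.
apply: (@le_trans _ _ (I (W *: \sum_(r | P r) w r *: H l (G r) ^+ 2))).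
  apply: le_sph_int => x hx; rewrite rmorphXn/= mevalB one0// sub0r sqrrN mevalZ !raddf_sum/=.
  rewrite (bigID P)/= [X in _ + X]big1 ?addr0 => [|r Pr]; last exact: out0.
  apply: (le_trans (weighted_sqr_sum_le _ _ w0)).
  rewrite /W ler_wpM2l//; first by apply: sumr_ge0 => r _; rewrite invr_ge0 ltW.
  by apply: ler_sum => r _; rewrite mevalZ rmorphXn.
rewrite linearZ/= raddf_sum/=; under eq_bigr do rewrite linearZ/=.
apply: ler_wpM2r.
  by apply: sumr_ge0 => r _; rewrite mulr_ge0 ?(ltW (w0 r))//; exact: sph_int_sqr_ge0.
(* Scale [r] reaches degree [l] exactly when [y <= 2 ^+ r], so the inverse weights add up to at most
   [2 / y / 2 ^+ S], which is [4 d / l]. *)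
pose y : R := l%:R / (2 * d%:R * 2 ^+ S).
have D0 : 0 < 2 * d%:R * 2 ^+ S :> R by rewrite !mulr_gt0 ?ltr0n// exprn_gt0.
have y0 : 0 < y by rewrite divr_gt0 ?ltr0n.
have PE r : P r = (y <= 2 ^+ r).
  rewrite /P /y ler_pdivrMr// -(ler_nat R) !natrM natrX exprD; congr (_ <= _); ring.
rewrite /W; under eq_bigl do rewrite PE.
under eq_bigr do rewrite /w exprD invfM.
rewrite -mulr_sumr; apply: (@le_trans _ _ ((2 ^+ S)^-1 * (2 / y))).
  by rewrite ler_wpM2l ?pow2_tail_sum// invr_ge0 exprn_ge0.
rewrite le_eqVlt; apply/orP; left; apply/eqP; rewrite /y; field.
by rewrite !pnatr_eq0 -!lt0n l0 d_gt0 expf_neq0 ?pnatr_eq0.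
Qed.

(** The weight of order [l ^ d] times the factor [1 / l] is at most a constant times
    [2 ^ ((d - 1) (S + r))] on the scales that reach [l], which raises [2 ^ (S + r)] to the weight
    of the hypothesis. Bessel's inequality then sums over [l] for each scale. *)
Lemma sobolev_energy_le (beta : R) : 1 / 2 < beta -> exists2 C : R, 0 < C &
  forall (S n : nat) (G : 'I_S -> mp), (0 < S)%N -> (0 < n)%N ->
    (forall r : 'I_S, deg_le (2 * (d * 2 ^ (S + r))) (G r)) ->
    \sum_(r < S) 2 ^+ (d * (S + r)) * I (G r ^+ 2) <= 4 * n%:R / S%:R ->
    (forall x, sph x -> 0 <= ev x (1 - \sum_r G r) <= 1) ->
    forall L, \sum_(l < L) (lambda_ab R d (d%:R / 2) beta l) ^- 2 *
        I (H l (1 - \sum_r G r) ^+ 2) <= C * n%:R * (S%:R `^ (beta - 1 / 2)) ^+ 2.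
Proof.
move=> hb; have b0 : 0 <= beta by lra.
have [D D0 lamD] := lambda_ab_bound d_gt0 b0.
pose C0 : R := (lambda_ab R d (d%:R / 2) beta 0) ^- 2.
have C00 : 0 <= C0 by rewrite /C0 lambda_ab_invsqr mulr_ge0 ?sqr_ge0.
pose C1 : R := 4 * d%:R * D * (2 * d%:R) ^+ d.-1.
have C10 : 0 <= C1 by rewrite !mulr_ge0 ?exprn_ge0 ?mulr_ge0// ltW.
(* [C0] pays for degree zero and [C1 * 4] for the positive degrees; the final 1 only makes the
   constant positive. *)
exists (C0 + C1 * 4 + 1); first by rewrite ltr_wpDl// addr_ge0// mulr_ge0.
move=> S n G S0 n0 Gdeg Gsum F01 L; set F := 1 - _; set s := _ `^ _.
have SR : 1 <= S%:R :> R by rewrite ler1n.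
have nR : 1 <= n%:R :> R by rewrite ler1n.
(* This uses [beta > 1 / 2] and lets [C0] be absorbed into [n%:R * s ^+ 2]. *)
have s1 : 1 <= s ^+ 2.
  rewrite expr_ge1//; last exact: powR_ge0.
  by rewrite -(powRr0 S%:R); apply: ler_powR => //; lra.
have ss : 0 <= s ^+ 2 * S%:R by rewrite mulr_ge0 ?sqr_ge0.
(* The factor [S%:R] isolated here is cancelled by the [1 / S] in the bound on the scales. *)
have sS : (S%:R `^ beta) ^+ 2 = s ^+ 2 * S%:R.
  have -> : beta = (beta - 1 / 2) + 2^-1 by field.
  rewrite powRD ?powR12_sqrt// ?exprMn ?sqr_sqrtr//.
  by rewrite pnatr_eq0 -lt0n S0 implybT.
pose e (r : 'I_S) l := I (H l (G r) ^+ 2).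
have e0 r l : 0 <= e r l by exact: sph_int_sqr_ge0.
have lam0 l : 0 <= (lambda_ab R d (d%:R / 2) beta l) ^- 2.
  by rewrite lambda_ab_invsqr mulr_ge0 ?sqr_ge0.
have pos l : (0 < l)%N -> (lambda_ab R d (d%:R / 2) beta l) ^- 2 * I (H l F ^+ 2) <=
    C1 * (s ^+ 2 * S%:R) * \sum_(r < S) 2 ^+ (d * (S + r)) * e r l.
  move=> l0; apply: (le_trans (ler_wpM2l (lam0 l) (proj_energy_le l0 Gdeg))).
  rewrite !mulr_sumr [leRHS](bigID (fun r : 'I_S => (l <= 2 * (d * 2 ^ (S + r)))%N))/=.
  rewrite -[leLHS]addr0 lerD//; last first.
    apply: sumr_ge0 => r _; apply: mulr_ge0; first exact: mulr_ge0.
    by apply: mulr_ge0 => //; exact: exprn_ge0.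
  apply: ler_sum => r lr; rewrite -/(e r l).
  have mulrA4 (a b c f : R) : a * (b * (c * f)) = a * b * c * f by rewrite !mulrA.
  rewrite mulrA4 [leRHS]mulrA ler_wpM2r//.
  have lS : (l <= 2 * (d * 2 ^ (S + S)))%N.
    by apply: (leq_trans lr); rewrite !leq_mul2l leq_exp2l// leq_add2l (ltnW (ltn_ord r)) !orbT.
  have lR : 0 < l%:R :> R by rewrite ltr0n.
  have lp : l%:R ^+ d.-1 <= (2 * d%:R) ^+ d.-1 * (2 ^+ (S + r)) ^+ d.-1 :> R.
    rewrite -exprMn; apply: lerXn2r; rewrite ?nnegrE ?mulr_ge0 ?exprn_ge0//.
    by move: lr; rewrite -(ler_nat R) !natrM natrX mulrA.
  apply: (@le_trans _ _ (D * (s ^+ 2 * S%:R) * l%:R ^+ d * (4 * d%:R / l%:R) * 2 ^+ (S + r))).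
    apply: ler_wpM2r; first exact: exprn_ge0.
    apply: ler_wpM2r; first by rewrite divr_ge0// mulr_ge0.
    by rewrite -sS; exact: lamD.
  have -> : D * (s ^+ 2 * S%:R) * l%:R ^+ d * (4 * d%:R / l%:R) * 2 ^+ (S + r) =
      (4 * d%:R * D * (s ^+ 2 * S%:R) * 2 ^+ (S + r)) * l%:R ^+ d.-1 :> R.
    have -> : l%:R ^+ d = l%:R * l%:R ^+ d.-1 :> R by rewrite -exprS prednK.
    by field; rewrite gt_eqF.
  have -> : C1 * (s ^+ 2 * S%:R) * 2 ^+ (d * (S + r)) = (4 * d%:R * D * (s ^+ 2 * S%:R) * 2 ^+ (S + r)) *
      ((2 * d%:R) ^+ d.-1 * (2 ^+ (S + r)) ^+ d.-1) :> R.
    have -> : 2 ^+ (d * (S + r)) = 2 ^+ (S + r) * (2 ^+ (S + r)) ^+ d.-1 :> R.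
      by rewrite [(d * _)%N]mulnC exprM -exprS prednK.
    by rewrite /C1; ring.
  apply: ler_wpM2l => //; apply: mulr_ge0; last exact: exprn_ge0.
  by apply: mulr_ge0 => //; apply: mulr_ge0; [exact: mulr_ge0|exact: ltW].
(* In degree zero the constant 1 does not project to zero; the bound [F <= 1] is used instead. *)
have zero : (lambda_ab R d (d%:R / 2) beta 0) ^- 2 * I (H 0 F ^+ 2) <= C0.
  rewrite -[leRHS]mulr1 ler_wpM2l//.
  have := proj_bessel sigP d_gt0 H_harmonic H_orth 1 F; rewrite big_ord1 => /le_trans; apply.
  rewrite -(sph_int1 sigP); apply: le_sph_int => x hx; rewrite rmorphXn/= meval1 expr_le1//.
    by have /andP[_] := F01 x hx.
  by have /andP[] := F01 x hx.
apply: (@le_trans _ _ (C0 + C1 * (s ^+ 2 * S%:R) * (4 * n%:R / S%:R))); last first.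
  have -> : C1 * (s ^+ 2 * S%:R) * (4 * n%:R / S%:R) = C1 * 4 * n%:R * s ^+ 2.
    by field; rewrite gt_eqF// (lt_le_trans ltr01).
  have : C0 <= C0 * (n%:R * s ^+ 2) by rewrite ler_peMr// mulr_ege1.
  have : 0 <= n%:R * s ^+ 2 by rewrite mulr_ge0 ?sqr_ge0.
  by rewrite !mulrDl -!mulrA mul1r; lra.
case: L => [|L].
  rewrite big_ord0; apply: addr_ge0 => //.
  by apply: mulr_ge0; [exact: mulr_ge0|rewrite divr_ge0// mulr_ge0].
rewrite big_ord_recl lerD//.
apply: (@le_trans _ _ (\sum_(l < L) C1 * (s ^+ 2 * S%:R) * \sum_(r < S) 2 ^+ (d * (S + r)) * e r (lift ord0 l))).
  by apply: ler_sum => l _; exact: pos.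
rewrite -mulr_sumr; apply: ler_wpM2l; first exact: mulr_ge0.
apply: le_trans Gsum; rewrite exchange_big/=; apply: ler_sum => r _.
rewrite -mulr_sumr ler_wpM2l ?exprn_ge0//.
apply: le_trans (proj_bessel sigP d_gt0 H_harmonic H_orth L.+1 (G r)).
by rewrite [leRHS]big_ord_recl lerDr; exact: sph_int_sqr_ge0.
Qed.

End Energy.

(** * Quadrature error for a given number of scales *)

Section LowerBound.
Variables (R : realType) (d : nat) (sig : probability (pt R d) R).
Hypothesis sigP : normalized_surface_measure R d sig.
Hypothesis d_ge2 : (2 <= d)%N.
Local Notation sph := (sphere R d).
Local Notation mp := (mpoly d.+1 R).
Local Notation ev x p := (meval (tnth x) p).
Local Notation I := (sph_int sig).

(** The fooling function vanishes at the nodes, so for any weights its quadrature error is its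
    integral; scaling by the energy bound puts it into the unit ball. *)
Lemma quad_err_lower_bound (beta : R) : 1 / 2 < beta -> exists2 C : R, 0 < C &
  forall (S n : nat) (c : 'I_n -> R) (X : 'I_n -> pt R d), (0 < S)%N -> (0 < n)%N ->
    (2 * n <= 2 ^ (d * S))%N -> (forall j, sph (X j)) ->
    exists2 f, H_unit_ball R d sig (d%:R / 2) beta f &
      C / (Num.sqrt n%:R * S%:R `^ (beta - 1 / 2)) <= quad_err R d n sig c X f.
Proof.
move=> hb; have d_gt0 : (0 < d)%N by exact: ltnW.
have [H [H_harmonic H_orth H_linear]] := exists_harmonic_projection sigP.
have [C C0 energy] := sobolev_energy_le sigP d_gt0 H_harmonic H_orth H_linear hb.
exists (1 / (2 * Num.sqrt C)); first by rewrite divr_gt0// mulr_gt0// sqrtr_gt0.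
move=> S n c X S0 n0 nS hX.
have [F [G [FX IF F01 Gdeg Gsum]]] := fooling_polynomial sigP d_gt0 S0 nS hX.
(* [F] and [F1] are only known to agree on the sphere; the energy bound concerns [F1]. *)
pose F1 : mp := 1 - \sum_r G r.
have F1E x : sph x -> ev x F1 = ev x F.
  move=> hx; have [_ ->] := F01 x hx; rewrite /F1 mevalB meval1.
  by congr (_ - _); rewrite raddf_sum.
have F101 x : sph x -> 0 <= ev x F1 <= 1 by move=> hx; rewrite F1E//; have [] := F01 x hx.
pose s := S%:R `^ (beta - 1 / 2).
have s0 : 0 < s by rewrite powR_gt0 ?ltr0n.
(* The inverse square root of the energy bound [C * n%:R * s ^+ 2]. *)
pose a := (Num.sqrt C * (Num.sqrt n%:R * s))^-1.
have a0 : 0 < a by rewrite invr_gt0 mulr_gt0 ?mulr_gt0 ?sqrtr_gt0// ltr0n.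
have aB : a ^+ 2 * (C * n%:R * s ^+ 2) = 1.
  rewrite /a exprVn !exprMn !sqr_sqrtr ?ler0n ?(ltW C0)// -mulrA mulVf// gt_eqF//.
  by rewrite !mulr_gt0 ?ltr0n ?exprn_gt0.
exists (fun x => ev x (a *: F1)); last first.
  rewrite /quad_err big1 => [|j _]; last by rewrite mevalZ F1E// FX !mulr0.
  rewrite subr0 sph_intE sph_intZ (@eq_sph_int _ _ _ F1 F F1E) [fine _]/=.
  apply: (@le_trans _ _ (a * (1 / 2))); last first.
    by apply: le_trans (ler_norm _); rewrite ler_pM2l.
  rewrite le_eqVlt; apply/orP; left; apply/eqP; rewrite /a -/s; field.
  by rewrite !gt_eqF// sqrtr_gt0 ?ltr0n.
split; first exact: measurable_funTS (measurable_meval _).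
split; first exact: continuous_on_sphere_meval.
exists (fun l x => ev x (H l (a *: F1))); split.
  by move=> l; exact: is_proj_harm_poly.
rewrite /H_norm2.
have HaE l : I (H l (a *: F1) ^+ 2) = a ^+ 2 * I (H l F1 ^+ 2).
  have HZ : H l (a *: F1) = a *: H l F1.
    have H0 : H l 0 = 0.
      have := H_linear l 1 0 0; rewrite !scale1r addr0 => /eqP.
      by rewrite -subr_eq0 opprD addrA subrr sub0r oppr_eq0 => /eqP.
    by rewrite -[a *: F1]addr0 H_linear H0 addr0.
  by rewrite HZ exprZn linearZ.
have termE l : (((lambda_ab R d (d%:R / 2) beta l) ^- 2)%:E *
    \int[sig]_(x in sph) ((ev x (H l (a *: F1))) ^+ 2)%:E)%E =
    (a ^+ 2 * ((lambda_ab R d (d%:R / 2) beta l) ^- 2 * I (H l F1 ^+ 2)))%:E.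
  rewrite (_ : (\int[sig]_(x in sph) _)%E = (I (H l (a *: F1) ^+ 2))%:E).
    by rewrite HaE -EFinM; congr EFin; ring.
  by rewrite -sph_intE; apply: eq_integral => x _; rewrite rmorphXn.
apply: lime_le.
  apply: is_cvg_nneseries => l _ _; rewrite termE lee_fin mulr_ge0 ?sqr_ge0//.
  apply: mulr_ge0; last exact: sph_int_sqr_ge0.
  by rewrite lambda_ab_invsqr mulr_ge0 ?sqr_ge0.
apply: nearW => L; under eq_bigr do rewrite termE.
rewrite sumEFin lee_fin -mulr_sumr -[leRHS]aB ler_pM2l ?exprn_gt0//.
by rewrite big_mkord; exact: energy.
Qed.

End LowerBound.

(** * Choice of the number of scales in terms of [ln n] *)

Unset Implicit Arguments.

Theorem theorem1p3 (R : realType) (d : nat) (beta : R) :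
  (2 <= d)%N -> 1 / 2 < beta ->
  forall sig : probability (pt R d) R, normalized_surface_measure R d sig ->
  exists2 c : R, 0 < c &
    forall n : nat, (2 <= n)%N ->
      ((c * (n%:R `^ (- (1 / 2))) * ((ln n%:R) `^ (- beta + 1 / 2)))%:E
        <= e_n R d sig (d%:R / 2) beta n)%E.
Proof.
move=> d2 hb sig sigP.
have [C C0 lower] := quad_err_lower_bound sigP d2 hb.
have ln2 : 0 < ln 2 :> R by rewrite ln_gt0// ltr1n.
(* One [1 / ln 2] converts to binary logarithms; the other absorbs the [.+1] in [S], since
   [ln 2 <= ln n]. *)
pose K : R := 2 / ln 2; have K0 : 0 < K by rewrite divr_gt0.
pose g := beta - 1 / 2; have g0 : 0 < g by rewrite subr_gt0.
exists (C / K `^ g); first by rewrite divr_gt0// powR_gt0.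
move=> n n2; have n0 : (0 < n)%N by exact: ltnW.
pose S := (trunc_log 2 n).+1.
have nS : (n < 2 ^ S)%N by exact: trunc_log_ltn.
have lnn : ln 2 <= ln n%:R :> R by rewrite ler_ln ?posrE ?ltr0n// ler_nat.
have SK : S%:R <= K * ln n%:R.
  have h : (trunc_log 2 n)%:R * ln 2 <= ln n%:R :> R.
    rewrite mulr_natl -lnXn// ler_ln ?posrE ?ltr0n ?exprn_gt0// -natrX ler_nat.
    exact: trunc_logP.
  rewrite /K -mulrA mulrCA mulrC ler_pdivlMr// /S -natr1 mulrDl mul1r; lra.
(* Both [2] and [n] are at most [2 ^ S], and [d] is at least 2. *)
have nS2 : (2 * n <= 2 ^ (d * S))%N.
  apply: (@leq_trans (2 ^ (2 * S))); last by rewrite leq_exp2l// leq_mul2r d2 orbT.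
  rewrite [(2 * S)%N]mul2n -addnn expnD leq_mul// ?(ltnW nS)//.
  by rewrite -{1}(expn1 2) leq_exp2l.
apply: le_ereal_inf_tmp => _ [c [X [hX ->]]].
have [f fball ferr] := lower S n c X isT n0 nS2 hX.
apply: (@le_trans _ _ (quad_err R d n sig c X f)%:E); last first.
  by apply: ereal_sup_ubound; exists f.
rewrite lee_fin; apply: le_trans ferr.
have -> : - beta + 1 / 2 = - g by rewrite /g; ring.
rewrite !powRN -/g -(powR12_sqrt (ler0n _ n)) mul1r.
rewrite -!mulrA ler_pM2l// -!invfM lef_pV2 ?posrE ?mulr_gt0 ?powR_gt0 ?ltr0n//; last first.
  by rewrite (lt_le_trans ln2).
rewrite mulrCA ler_pM2l ?powR_gt0 ?ltr0n// -powRM ?(ltW K0) ?(le_trans (ltW ln2))//.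
by apply: ge0_ler_powR; rewrite ?nnegrE ?(ltW g0)// mulr_ge0 ?(ltW K0)// (le_trans (ltW ln2)).
Qed.
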